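(* Let $Z$ be a $JC^*$-triple system spanned by a finite rectangular grid $\{u_1,\ldots,u_n\}$ of rank $1$. Then $T^*(Z)$ is TRO-isomorphic to \[\bigoplus_{k=1}^n\mathbb{M}_{p_k,q_k},\] where $p_k=\binom{n}{k}$ and $q_k=\binom{n}{k-1}$ for all $k=1,\ldots,n$.
   Context: $\mathbb{M}_{p,q}$ denotes the complex $p\times q$-matrices. A $JC^*$-triple system is a closed subspace of a $C^*$-algebra invariant under $\{a,b,c\}=\frac12(ab^*c+cb^*a)$; a $JB^*$-triple homomorphism is a linear map preserving the triple product. A tripotent is an element $e$ with $\{e,e,e\}=e$. A finite rectangular grid of rank $1$ is a set $\{u_1,\ldots,u_n\}$ of ($n$ distinct, non-zero) tripotents with (RG'1) $\{u_i,u_j,u_i\}=0$ for $i\neq j$; (RG'2) $\{u_i,u_i,u_k\}=\frac12u_k$ for $i\neq k$; (RG'3) all other triple products of grid elements (apart from $\{u_i,u_i,u_i\}=u_i$ and those obtained by symmetry in the outer variables) are $0$. A TRO is a closed subspace $T\subseteq B(H)$, $H$ a Hilbert space, with $xy^*z\in T$ for all $x,y,z\in T$; it carries the triple product $\frac12(xy^*z+zy^*x)$. TRO-homomorphisms are linear maps preserving $xy^*z$. The universal enveloping TRO of $Z$ is the TRO $T^*(Z)$, unique up to TRO-isomorphism, with a $JB^*$-triple homomorphism $\rho_Z:Z\to T^*(Z)$ such that $\rho_Z(Z)$ generates $T^*(Z)$ as a TRO and every $JB^*$-triple homomorphism $\alpha:Z\to T$ into a TRO $T$ factors as $\alpha=T^*(\alpha)\circ\rho_Z$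 with $T^*(\alpha):T^*(Z)\to T$ a TRO-homomorphism. *)

(* Defs.v *)
From HB Require Import structures.
From mathcomp Require Import all_boot all_order all_algebra.
From mathcomp Require Import complex.
From mathcomp Require Import boolp classical_sets functions reals topology normedtype.

Set Implicit Arguments.
Unset Strict Implicit.
Unset Printing Implicit Defensive.

Import Order.TTheory GRing.Theory Num.Theory.
Import numFieldNormedType.Exports.

Local Open Scope classical_set_scope.
Local Open Scope ring_scope.

(** * Subspaces closed under a ternary product, and their homomorphisms *)

Section Ternary.
Variable K : fieldType.

Definition subspace (V : lmodType K) (S : set V) : Prop :=
  S 0 /\ forall (a : K) (x y : V), S x -> S y -> S (a *: x + y).

Definition ternary_closed (V : lmodType K) (m : V -> V -> V -> V) (S : set V)
  : Prop := forall x y z, S x -> S y -> S z -> S (m x y z).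

(* With [m x y z = x y^* z] this is the triple product [{x, y, z}]. *)
Definition jordan (V : lmodType K) (m : V -> V -> V -> V) (x y z : V) : V :=
  2^-1 *: (m x y z + m z y x).

(* Only the restriction of [f] to [S] matters. *)
Definition ternary_hom (V W : lmodType K)
    (m : V -> V -> V -> V) (m' : W -> W -> W -> W)
    (S : set V) (S' : set W) (f : V -> W) : Prop :=
  [/\ forall x, S x -> S' (f x),
      forall (a : K) x y, S x -> S y -> f (a *: x + y) = a *: f x + f y
    & forall x y z, S x -> S y -> S z -> f (m x y z) = m' (f x) (f y) (f z)].

Definition ternary_iso (V W : lmodType K)
    (m : V -> V -> V -> V) (m' : W -> W -> W -> W)
    (S : set V) (S' : set W) : Prop :=
  exists f : V -> W, ternary_hom m m' S S' f /\ set_bij S S' f.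

Definition linspan (V : lmodType K) (n : nat) (u : 'I_n -> V) : set V :=
  [set x | exists c : 'I_n -> K, x = \sum_(i < n) c i *: u i].

End Ternary.

(** * C*-algebras (not necessarily unital) and JC*-triple systems *)

Record cstarAlgebra (R : realType) := CStarAlgebra {
  cs_sort :> completeNormedModType R[i];
  cs_mul : {bilinear cs_sort -> cs_sort -> cs_sort};
  cs_star : cs_sort -> cs_sort;
  cs_mulA : associative cs_mul;
  cs_normM : forall x y, `|cs_mul x y| <= `|x| * `|y|;
  cs_starD : {morph cs_star : x y / x + y};
  cs_starZ : forall (a : R[i]) x, cs_star (a *: x) = conjc a *: cs_star x;
  cs_starK : involutive cs_star;
  cs_starM : forall x y, cs_star (cs_mul x y) = cs_mul (cs_star y) (cs_star x);
  cs_cstar : forall x, `|cs_mul (cs_star x) x| = `|x| ^+ 2 }.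

Arguments cs_mul {R c}.
Arguments cs_star {R c}.

Definition cs_tern (R : realType) (A : cstarAlgebra R) (x y z : A) : A :=
  cs_mul (cs_mul x (cs_star y)) z.

Definition jc_triple (R : realType) (A : cstarAlgebra R) (Z : set A) : Prop :=
  [/\ subspace Z, closed Z & ternary_closed (jordan (@cs_tern R A)) Z].

Record rank1_grid (R : realType) (A : cstarAlgebra R) (n : nat)
    (u : 'I_n -> A) : Prop := Rank1Grid {
  rg_inj : injective u;
  rg_neq0 : forall i, u i != 0;
  rg_tripotent : forall i, jordan (@cs_tern R A) (u i) (u i) (u i) = u i;
  rg_1 : forall i j, i != j -> jordan (@cs_tern R A) (u i) (u j) (u i) = 0;
  rg_2 : forall i k, i != k ->
    jordan (@cs_tern R A) (u i) (u i) (u k) = 2^-1 *: u k;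
  (* [{u_i, u_j, u_k}] is not covered by the axioms above, up to exchanging
     [i] and [k], exactly when the three indices are pairwise distinct. *)
  rg_3 : forall i j k, i != j -> j != k -> i != k ->
    jordan (@cs_tern R A) (u i) (u j) (u k) = 0 }.

(** * Hilbert spaces, B(H) and TROs *)

(* The inner product is linear in its first argument. *)
Record hilbertSpace (R : realType) := HilbertSpace {
  hs_sort :> completeNormedModType R[i];
  hs_dot : {dot hs_sort for (@conjc R)};
  hs_normE : forall x, `|x| ^+ 2 = hs_dot x x }.

Arguments hs_dot {R h}.

Section Operators.
Variables (R : realType) (H : hilbertSpace R).

Definition bounded_op : set (H -> H) := [set f | linear f /\ continuous f].

(* By Riesz representation, the set of candidates is a singleton whenever [f]
   is in [bounded_op]. *)
Definition adjoint (f : H -> H) : H -> H :=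
  xget 0 [set g | bounded_op g /\
                  forall x y, hs_dot (f x) y = hs_dot x (g y)].

(* Closedness in B(H) for the operator norm:
   [||f - g|| <= e] iff [|f x - g x| <= e * |x|] for all [x]. *)
Definition opnorm_closed (T : set (H -> H)) : Prop :=
  forall f, bounded_op f ->
    (forall e : R[i], 0 < e ->
       exists2 g, T g & forall x, `|f x - g x| <= e * `|x|) ->
    T f.

Definition op_tern (f g h : H -> H) : H -> H := f \o adjoint g \o h.

Definition tro (T : set (H -> H)) : Prop :=
  [/\ T `<=` bounded_op, subspace T, opnorm_closed T
    & ternary_closed op_tern T].

Definition tro_generated_by (T X : set (H -> H)) : Prop :=
  X `<=` T /\ forall S, tro S -> X `<=` S -> T `<=` S.

End Operators.

Section Universal.
Variable R : realType.

Definition jb_hom (A : cstarAlgebra R) (Z : set A) (H : hilbertSpace R)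
    (T : set (H -> H)) (f : A -> H -> H) : Prop :=
  ternary_hom (jordan (@cs_tern R A)) (jordan (@op_tern R H)) Z T f.

Definition tro_hom (H H' : hilbertSpace R) (T : set (H -> H))
    (T' : set (H' -> H')) (f : (H -> H) -> H' -> H') : Prop :=
  ternary_hom (@op_tern R H) (@op_tern R H') T T' f.

Definition universal_enveloping_tro (A : cstarAlgebra R) (Z : set A)
    (H : hilbertSpace R) (T : set (H -> H)) (rho : A -> H -> H) : Prop :=
  [/\ tro T, jb_hom Z T rho, tro_generated_by T (rho @` Z)
    & forall (H' : hilbertSpace R) (T' : set (H' -> H')) (alpha : A -> H' -> H'),
        tro T' -> jb_hom Z T' alpha ->
        exists2 phi : (H -> H) -> H' -> H', tro_hom T T' phi
          & forall z, Z z -> alpha z = phi (rho z)].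

End Universal.

(** * Finite direct sums of rectangular matrix spaces *)

Section Dirsum.
Variables (K : nzRingType) (I : finType) (V : I -> lmodType K).

Definition dirsum := {dffun forall i : I, V i}.

HB.instance Definition _ := Choice.on dirsum.

Implicit Types f g h : dirsum.

Let add f g : dirsum := [ffun i : I => (f i + g i : V i)].
Let opp f : dirsum := [ffun i : I => (- f i : V i)].
Let zero : dirsum := [ffun i : I => (0 : V i)].
Let scale (a : K) f : dirsum := [ffun i : I => (a *: f i : V i)].

Let addA : associative add.
Proof. by move=> f g h; apply/ffunP => i; rewrite !ffunE addrA. Qed.
Let addC : commutative add.
Proof. by move=> f g; apply/ffunP => i; rewrite !ffunE addrC. Qed.
Let add0 : left_id zero add.
Proof. by move=> f; apply/ffunP => i; rewrite !ffunE add0r. Qed.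
Let addN : left_inverse zero opp add.
Proof. by move=> f; apply/ffunP => i; rewrite !ffunE addNr. Qed.

HB.instance Definition _ := GRing.isZmodule.Build dirsum addA addC add0 addN.

Let scaleA (a b : K) f : scale a (scale b f) = scale (a * b) f.
Proof. by apply/ffunP => i; rewrite !ffunE scalerA. Qed.
Let scale1 : left_id 1 scale.
Proof. by move=> f; apply/ffunP => i; rewrite !ffunE scale1r. Qed.
Let scaleDr : right_distributive scale +%R.
Proof. by move=> a f g; apply/ffunP => i; rewrite !ffunE scalerDr. Qed.
Let scaleDl f : {morph scale^~ f : a b / a + b}.
Proof. by move=> a b; apply/ffunP => i; rewrite !ffunE scalerDl. Qed.

HB.instance Definition _ :=
  GRing.Zmodule_isLmodule.Build K dirsum scaleA scale1 scaleDr scaleDl.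

End Dirsum.

Definition mx_tern (R : realType) (p q : nat) (x y z : 'M[R[i]]_(p, q)) :
  'M[R[i]]_(p, q) := x *m map_mx (@conjc R) y^T *m z.

Definition mxsum (R : realType) (I : finType) (p q : I -> nat)
  : lmodType R[i] := dirsum (fun k : I => 'M[R[i]]_(p k, q k) : lmodType R[i]).

Definition mxsum_tern (R : realType) (I : finType) (p q : I -> nat)
    (x y z : mxsum R p q) : mxsum R p q :=
  [ffun k : I => mx_tern (x k) (y k) (z k)].

(* Main.v *)
Require Import Defs.
From HB Require Import structures.
From mathcomp Require Import all_boot all_order all_algebra complex.
From mathcomp Require Import ring zify.
From mathcomp Require Import boolp classical_sets functions reals topology normedtype.

Set Implicit Arguments.
Unset Strict Implicit.
Unset Printing Implicit Defensive.

Import Order.TTheory GRing.Theory Num.Theory Num.Def.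
Import numFieldNormedType.Exports.

Local Open Scope classical_set_scope.
Local Open Scope ring_scope.

(* [topology] exports a type also named [subspace]. *)
Local Notation subspace := Defs.subspace.

(** Polarised, the grid relations say that
    [u_i u_j^* u_k + u_k u_j^* u_i = d_ij u_k + d_jk u_i].  Hence in any TRO
    generated by a grid, a word [u_i0 u_j1^* u_i1 ... u_jm^* u_im] is, modulo
    shorter words, antisymmetric in its [i]'s and in its [j]'s, so the TRO is
    spanned by the words attached to the pairs [(I, J)] of subsets of
    [{1, .., n}] with [#|I| = #|J| + 1].  On the other hand the creation
    operators on the exterior algebra of [C^n] form a grid, and generate all
    matrix units [E_IJ] with [#|I| = #|J| + 1].  The universal property provides
    a surjection from the former TRO to the latter; as both sides are indexed
    by the same pairs, it is an isomorphism. *)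

(** * Finite-dimensional Hilbert spaces *)

(** Creation operators satisfy the grid relation because, in [u_i u_j^* u_k + u_k u_j^* u_i], the
    anticommutation relations move the annihilator to the left, and the remaining terms cancel. An
    odd word in them raises the degree by exactly one, so its matrix splits into one block for each
    size k < n of J. The number of pairs with that k is the product of the binomials of n over k + 1
    and of n over k, which is the size of the block. Two analytic points shape the argument.
    [adjoint] is a chosen value with default [0], so an operator must be shown to have an adjoint
    before words in it can be conjugated; for the images of grid elements this comes from their
    being tripotents. Moreover, minimality compares the enveloping TRO only with norm-closed
    subspaces, so finite-dimensional spans of operators have to be proved closed. *)

Section DotSpace.
Variables (C : numClosedFieldType) (U : lmodType C) (form : {dot U for conjC}).
Local Notation "''[' u , v ]" := (form u v) : ring_scope.

(** Pythagoras for [u = w + a *: v], where [a *: v] is the projection of [u] on the line of [v]. *)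
Lemma dot_CauchySchwarz u v : `|'[u, v]| <= sqrtC '[u, u] * sqrtC '[v, v].
Proof.
rewrite -(sqrCK (normr_ge0 _)) -sqrtCM ?nnegrE ?dnorm_ge0//
  ler_sqrtC ?nnegrE ?mulr_ge0 ?exprn_ge0 ?dnorm_ge0//.
have [->|v0] := eqVneq v 0;
  first by rewrite linear0r normr0 expr0n linear0r mulr0.
set a := '[u, v] / '[v, v]; set w := u - a *: v.
have ow : '[w, v] = 0 by rewrite linearBl linearZl_LR /= divfK ?dnorm_eq0
  ?subrr.
have -> : '[u, u] = '[w, w] + `|a| ^+ 2 * '[v, v].
  rewrite -dnormZ -hnormDd ?subrK//.
  by rewrite linearZr_LR /= ow mulr0.
rewrite mulrDl -[X in X <= _]add0r lerD ?mulr_ge0 ?dnorm_ge0//.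
by rewrite -mulrA -expr2 normrM normfV (ger0_norm (dnorm_ge0 _ v)) exprMn
  exprVn mulfVK ?expf_neq0 ?dnorm_eq0.
Qed.

Lemma sqrt_dnormD u v :
  sqrtC '[u + v, u + v] <= sqrtC '[u, u] + sqrtC '[v, v].
Proof.
rewrite -ler_sqr ?nnegrE ?addr_ge0 ?sqrtC_ge0 ?dnorm_ge0//.
rewrite sqrrD !sqrtCK dnormD [leRHS]addrAC lerD2l -mulr_natl.
apply: le_trans (real_ler_norm _) _;
  first by rewrite CrealE rmorphD /= conjCK addrC.
apply: le_trans (ler_normD _ _) _.
by rewrite norm_conjC mulr_natl mulr2n lerD ?dot_CauchySchwarz.
Qed.

End DotSpace.

Section Ell2.
Variables (R : realType) (I : finType).
Local Notation C := R[i].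

Definition ell2 : Type := {ffun I -> C^o}.
HB.instance Definition _ := GRing.Lmodule.on ell2.

Lemma ell2_scaleE (a : C) (x : ell2) i : (a *: x) i = a * x i.
Proof. by rewrite ffunE. Qed.

Definition ell2_dot (x y : ell2) : C := \sum_i x i * (y i)^*%C.

Lemma ell2_dot_bilinear : bilinear_for
  (GRing.Scale.Law.clone _ _ ( *%R ) _)
  (GRing.Scale.Law.clone _ _ (@conjc R \; *%R ) _) ell2_dot.
Proof.
split=> [y|x] a u v /=; rewrite /ell2_dot mulr_sumr -big_split;
  apply: eq_bigr => i _ /=; rewrite !ffunE.
- by rewrite mulrDl mulrA.
- by rewrite rmorphD rmorphM mulrDr mulrCA.
Qed.

HB.instance Definition _ := bilinear_isBilinear.Build C ell2 ell2 C
  (GRing.Scale.Law.clone _ _ ( *%R ) _)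
  (GRing.Scale.Law.clone _ _ (@conjc R \; *%R ) _) ell2_dot ell2_dot_bilinear.

Lemma ell2_dot_hermitian x y :
  ell2_dot x y = (-1) ^+ false * (ell2_dot y x)^*%C.
Proof.
rewrite expr0 mul1r /ell2_dot rmorph_sum; apply: eq_bigr => i _.
by rewrite rmorphM /= conjcK mulrC.
Qed.

HB.instance Definition _ := @isHermitianSesquilinear.Build C ell2 false
  (@conjc R) ell2_dot ell2_dot_hermitian.

Lemma ell2_dotE (x : ell2) : ell2_dot x x = \sum_i `|x i| ^+ 2.
Proof. by apply: eq_bigr => i _; rewrite sqr_normc. Qed.

Lemma ell2_dot_gt0 (x : ell2) : x != 0 -> 0 < ell2_dot x x.
Proof.
move=> x0; have [i xi] : exists i, x i != 0.
  by apply/existsP; apply: contra_neqT x0 => /existsPn x0;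
    apply/ffunP => i; rewrite ffunE; apply/eqP/negPn.
rewrite ell2_dotE (bigD1 i)//= ltr_wpDr ?exprn_gt0 ?normr_gt0//.
by apply: sumr_ge0 => j _; rewrite exprn_ge0.
Qed.

HB.instance Definition _ := isDotProduct.Build C ell2 ell2_dot ell2_dot_gt0.

(** The same form is read below with [conjC] in place of [conjc]: the two are convertible on [R[i]],
    so the general facts on dot products apply. *)
Definition ell2_form : {dot ell2 for @conjc R} := ell2_dot.

Let normE (x : ell2) := sqrtC (ell2_dot x x).

Let normD x y : normE (x + y) <= normE x + normE y.
Proof. exact: (sqrt_dnormD (ell2_form : {dot ell2 for conjC})). Qed.

Let normZ (a : C) x : normE (a *: x) = `|a| * normE x.
Proof.
rewrite /normE (dnormZ (ell2_form : {dot ell2 for conjC})).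
by rewrite sqrtCM ?sqrCK ?nnegrE ?exprn_ge0//
  (dnorm_ge0 (ell2_form : {dot ell2 for conjC})).
Qed.

Let norm0_eq0 x : normE x = 0 -> x = 0.
Proof.
by move=> /eqP; rewrite (sqrt_dnorm_eq0 (ell2_form : {dot ell2 for conjC})) =>
  /eqP.
Qed.

HB.instance Definition _ := Lmodule_isNormed.Build C ell2 normD normZ norm0_eq0.

Lemma ell2_normE (x : ell2) : `|x| ^+ 2 = ell2_dot x x.
Proof. by rewrite /Num.norm /= sqrtCK. Qed.

Lemma ell2_coord_le (x : ell2) i : `|x i| <= `|x|.
Proof.
rewrite -ler_sqr ?nnegrE// ell2_normE ell2_dotE (bigD1 i)//= lerDl.
by apply: sumr_ge0 => j _; rewrite exprn_ge0.
Qed.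

Definition ell2_basis (i : I) : ell2 := [ffun j => (j == i)%:R].

Lemma ell2_sum_basis (x : ell2) : x = \sum_i x i *: ell2_basis i.
Proof.
apply/ffunP => j.
rewrite (big_morph (fun f : ell2 => f j) (id1 := 0) (op1 := +%R)); last 2 first.
- by move=> f g; rewrite ffunE.
- by rewrite ffunE.
have eE i : (x i *: ell2_basis i) j = x i * (j == i)%:R.
  by rewrite ell2_scaleE ffunE.
rewrite (eq_bigr _ (fun i _ => eE i)) (bigD1 j)// eqxx mulr1.
by rewrite big1 => [|i /negPf];
  [rewrite [RHS]addr0|rewrite eq_sym => ->; rewrite mulr0].
Qed.

Lemma ell2_basis_norm i : `|ell2_basis i| = 1.
Proof.
rewrite /Num.norm /= /normE ell2_dotE (bigD1 i)//= ffunE eqxx normr1 expr1n.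
by rewrite big1 ?addr0 ?sqrtC1// => j /negPf ji; rewrite ffunE ji normr0 expr0n.
Qed.

Lemma ell2_norm_le_sum (x : ell2) : `|x| <= \sum_i `|x i|.
Proof.
rewrite {1}[x]ell2_sum_basis; apply: le_trans (ler_norm_sum _ _ _) _.
by apply: ler_sum => i _; rewrite normrZ ell2_basis_norm mulr1.
Qed.

Let normc_ge_Im (z : C) : `|complex.Im z|%:C%C <= `|z|.
Proof.
by rewrite normc_def lecR -sqrtr_sqr ler_wsqrtr// lerDr sqr_ge0.
Qed.

Let normc_le_ReIm (z : C) : `|z| <= (`|complex.Re z| + `|complex.Im z|)%:C%C.
Proof.
rewrite {1}[z]complexE; apply: le_trans (ler_normD _ _) _.
rewrite normrM !normc_def /= !expr0n /= !addr0 expr1n add0r sqrtr1 mul1r.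
by rewrite !sqrtr_sqr -rmorphD.
Qed.

(** Completeness comes from [R]: a coordinate followed by [Re] or [Im] is an additive 1-Lipschitz
    map to [R], so it sends Cauchy filters to convergent ones. *)
Let cauchy_part (p : C -> R) (F : set_system ell2) (FF : ProperFilter F) i :
  (forall z w : C, p (z - w) = p z - p w) ->
  (forall z : C, `|p z|%:C%C <= `|z|) ->
  cauchy F -> cvg ((fun x : ell2 => p (x i)) @ F).
Proof.
move=> pB ple /cauchyP Fc; apply: cauchy_cvg; apply: cauchy_exP => e e0.
have [|x Fx] := Fc e%:C%C; first by rewrite ltcR.
exists (p (x i)).
suff : F [set y : ell2 | ball (p (x i)) e (p (y i))] by [].
apply: filterS Fx => y; rewrite /= -!ball_normE /= => xy; rewrite -pB -ltcR.
apply: le_lt_trans (ple _) _; apply: le_lt_trans xy.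
by have := ell2_coord_le (x - y) i; rewrite !ffunE.
Qed.

Lemma ell2_complete (F : set_system ell2) : ProperFilter F -> cauchy F -> cvg F.
Proof.
move=> FF Fc; apply/cvg_ex.
have cRe i : cvg ((fun x : ell2 => complex.Re (x i)) @ F).
  by apply: cauchy_part => [z w|z|//]; [exact: raddfB|exact: normc_ge_Re].
have cIm i : cvg ((fun x : ell2 => complex.Im (x i)) @ F).
  by apply: cauchy_part => [z w|z|//]; [exact: raddfB|exact: normc_ge_Im].
pose l : ell2 := [ffun i => (lim ((fun x : ell2 => complex.Re (x i)) @ F)
                  +i* lim ((fun x : ell2 => complex.Im (x i)) @ F))%C].
exists l; apply/cvgrPdist_le => /= e e0.
have [r r0 re] : exists2 r : R, 0 < r & e = r%:C%C.
  by exists (complex.Re e); rewrite -?ltcR RRe_real ?gtr0_real.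
(* Each coordinate contributes at most [d + d] (real and imaginary part) to the norm. The successor
   keeps the denominator nonzero when [I] is empty; the surplus summand is discarded below. *)
pose d : R := r / (2 * #|I|.+1%:R).
have d0 : 0 < d by rewrite divr_gt0 ?mulr_gt0 ?ltr0n.
have near_part : F [set x : ell2 | forall i,
    `|complex.Re (l i) - complex.Re (x i)| <= d /\
    `|complex.Im (l i) - complex.Im (x i)| <= d].
  apply: filter_forall => i; rewrite /l ffunE /=; apply: filterI.
  - by have /cvgrPdist_le := cRe i; apply.
  - by have /cvgrPdist_le := cIm i; apply.
apply: filterS near_part => x xd; apply: le_trans (ell2_norm_le_sum _) _.
have -> : e = \sum_(i < #|I|.+1) (d + d)%:C%C.
  rewrite sumr_const card_ord -rmorphMn re; congr _%:C%C.
  by rewrite -mulr2n -[d *+ 2]mulr_natl -mulr_natl /d; field;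
    rewrite addrC natr1 pnatr_eq0.
rewrite big_ord_recr /= -[X in X <= _]addr0; apply: lerD; last first.
  by rewrite ler0c addr_ge0 ?ltW.
rewrite sumr_const card_ord -sumr_const; apply: ler_sum => i _.
apply: le_trans (normc_le_ReIm _) _; rewrite lecR !ffunE !raddfD !raddfN.
by have [h1 h2] := xd i; rewrite lerD ?h1//; move: h1 h2; rewrite /l ffunE.
Qed.

HB.instance Definition _ := Uniform_isComplete.Build ell2 ell2_complete.

Definition ell2_hilbert : hilbertSpace R :=
  @HilbertSpace R ell2 ell2_form ell2_normE.

End Ell2.

(** * Operators with an adjoint *)

Section Adjoints.
Variables (R : realType) (H : hilbertSpace R).
Local Notation C := R[i].
Local Notation "''[' u , v ]" := (hs_dot u v) : ring_scope.
Implicit Types (f g h : H -> H) (x y : H).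

Definition adjoints f g :=
  [/\ bounded_op f, bounded_op g & forall x y, '[f x, y] = '[x, g y]].

Lemma hs_dotC x y : '[x, y] = ('[y, x])^*%C.
Proof. by have := hermC (@hs_dot R H) x y; rewrite expr0 mul1r. Qed.

Lemma hs_dotPl (a : C) x y z : '[a *: x + y, z] = a * '[x, z] + '[y, z].
Proof. by rewrite linearDl linearZl_LR. Qed.

Lemma hs_dotPr (a : C) x y z : '[z, a *: x + y] = a^*%C * '[z, x] + '[z, y].
Proof. by rewrite linearDr linearZr_LR. Qed.

Lemma hs_dot_eq0 x : '[x, x] = 0 -> x = 0.
Proof. by rewrite -hs_normE => /eqP; rewrite sqrf_eq0 normr_eq0 => /eqP. Qed.

Lemma hs_dot_inj x y : (forall z, '[z, x] = '[z, y]) -> x = y.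
Proof.
move=> xy; apply/eqP; rewrite -subr_eq0; apply/eqP/hs_dot_eq0.
by rewrite linearBr /= xy subrr.
Qed.

Lemma hs_dot_le x y : `|'[x, y]| <= `|x| * `|y|.
Proof.
have := dot_CauchySchwarz (@hs_dot R H : {dot H for conjC}) x y.
by rewrite -!hs_normE !sqrCK.
Qed.

Lemma op_linE a f g x : (a *: f + g) x = a *: f x + g x.
Proof. by []. Qed.

Lemma bounded_op_lin a f g :
  bounded_op f -> bounded_op g -> bounded_op (a *: f + g).
Proof.
move=> [fl fc] [gl gc]; split=> [b x y|x].
  rewrite !op_linE fl gl.
  by rewrite !scalerDr !scalerA [a * b]mulrC addrACA.
exact: (cvgD (cvgZl_tmp (fc x)) (gc x)).
Qed.

Lemma bounded_op0 : bounded_op (0 : H -> H).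
Proof.
split=> [b x y|x]; last exact: cvg_cst.
by rewrite /= scaler0 addr0.
Qed.

Lemma bounded_op_comp f g :
  bounded_op f -> bounded_op g -> bounded_op (f \o g).
Proof.
move=> [fl fc] [gl gc]; split=> [b x y|x]; first by rewrite /= gl fl.
by apply: continuous_comp; [exact: gc|exact: fc].
Qed.

Lemma adjoint_bounded f : bounded_op (adjoint f).
Proof.
rewrite /adjoint; case: xgetP => [g _ [gb _]//|_]; exact: bounded_op0.
Qed.

Lemma adjointE f g : adjoints f g -> adjoint f = g.
Proof.
move=> [fb gb fg]; rewrite /adjoint.
case: xgetP => [g' _ [_ fg']|/(_ g)]; last by move=> /(_ (conj gb fg)).
by apply/funext => y; apply: hs_dot_inj => x; rewrite -fg'.
Qed.

Lemma adjoints_sym f g : adjoints f g -> adjoints g f.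
Proof. by case=> fb gb fg; split=> // x y; rewrite hs_dotC -fg -hs_dotC. Qed.

Lemma adjoints_comp f f' g g' :
  adjoints f f' -> adjoints g g' -> adjoints (f \o g) (g' \o f').
Proof.
by move=> [? ? ff'] [? ? gg']; split=> [||x y /=];
  rewrite ?ff' ?gg'//; exact: bounded_op_comp.
Qed.

Lemma adjoints_lin a f f' g g' :
  adjoints f f' -> adjoints g g' -> adjoints (a *: f + g) (a^*%C *: f' + g').
Proof.
move=> [? ? ff'] [? ? gg']; split=> [||x y /=]; try exact: bounded_op_lin.
by rewrite !op_linE hs_dotPl hs_dotPr conjcK ff' gg'.
Qed.

Lemma adjoints0 : adjoints (0 : H -> H) 0.
Proof.
split=> [||x y]; [exact: bounded_op0|exact: bounded_op0|].
by rewrite linear0l linear0r.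
Qed.

(* An operator without adjoint is sent to the junk value [0], so the tripotent
   equation forces it to vanish; this replaces the Riesz theorem. *)
Lemma adjoints_tripotent f :
  bounded_op f -> f \o adjoint f \o f = f -> adjoints f (adjoint f).
Proof.
move=> fb; rewrite /adjoint; case: xgetP => [g _ [gb fg] _//|_ f0].
have -> : f = 0.
  rewrite -f0; apply/funext => x /=; have [fl _] := fb.
  by have := fl (-1) 0 0; rewrite !scaleN1r !addNr => ->.
exact: adjoints0.
Qed.

(** All of B(H) serves as the target TRO, so that the one generated by the creation operators never
    has to be described. *)
Lemma tro_bounded_op : tro (@bounded_op R H).
Proof.
split=> //.
- by split=> [|a f g]; [exact: bounded_op0|exact: bounded_op_lin].
- move=> f g h fb _ hb; apply: bounded_op_comp => //.
  by apply: bounded_op_comp => //; exact: adjoint_bounded.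
Qed.

End Adjoints.

(** * Finite-dimensional subspaces of B(H) *)

Section Linspan.
Variables (K : fieldType) (V : lmodType K).

Lemma linspan_recl m (w : 'I_m.+1 -> V) x :
  linspan w x <-> exists a, linspan (w \o lift ord0) (x - a *: w ord0).
Proof.
split=> [[c ->]|[a [c /eqP]]].
  exists (c ord0), (c \o lift ord0).
  by rewrite big_ord_recl addrC addKr.
rewrite subr_eq addrC => /eqP ->; exists (fun i => oapp c a (unlift ord0 i)).
rewrite big_ord_recl unlift_none /=; congr (_ + _).
by apply: eq_bigr => i _; rewrite liftK.
Qed.

Lemma linspan_subspace m (w : 'I_m -> V) : subspace (linspan w).
Proof.
split=> [|a x y]; last first.
  move=> [c ->] [d ->]; exists (fun i => a * c i + d i).
  rewrite scaler_sumr -big_split /=.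
  by apply: eq_bigr => i _; rewrite scalerDl scalerA.
by exists (fun=> 0); rewrite big1 // => i _; rewrite scale0r.
Qed.

Lemma subspace_sum (S : set V) (I : finType) (c : I -> K) (w : I -> V) :
  subspace S -> (forall i, S (w i)) -> S (\sum_i c i *: w i).
Proof.
move=> [S0 SP] Sw; elim/big_ind: _ => // [x y Sx Sy|i _].
  by rewrite -[x]scale1r; exact: SP.
by rewrite -[_ *: _]addr0; exact: SP.
Qed.

Lemma subspaceZ (S : set V) a x : subspace S -> S x -> S (a *: x).
Proof. by move=> [S0 SP] Sx; rewrite -[_ *: _]addr0; exact: SP. Qed.

Lemma subspaceD (S : set V) x y : subspace S -> S x -> S y -> S (x + y).
Proof. by move=> [S0 SP] Sx Sy; rewrite -[x]scale1r; exact: SP. Qed.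

Lemma subspaceB (S : set V) x y : subspace S -> S x -> S y -> S (x - y).
Proof. by move=> SS Sx Sy; rewrite -scaleN1r addrC; exact: SS.2. Qed.

Lemma sum_delta m (w : 'I_m -> V) i : \sum_j (j == i)%:R *: w j = w i.
Proof.
rewrite (bigD1 i)//= eqxx scale1r big1 ?addr0// => j /negPf ->.
by rewrite scale0r.
Qed.

Lemma linspan_gen m (w : 'I_m -> V) i : linspan w (w i).
Proof.
by exists (fun j => (j == i)%:R); rewrite sum_delta.
Qed.

(** Elimination, one vector at a time. If [l1] separates [w ord0] from the other vectors and [l2]
    separates [f - a *: w ord0] from them, then [l2] minus a multiple of [l1] kills every vector and
    takes at [f] the value of [l2] at [f - a *: w ord0]. The class [L] carries along whatever
    regularity the functionals have. *)
Lemma separate_from_linspan (L : set (V -> K)) :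
    (forall l, L l -> scalar l) ->
    (forall a l l', L l -> L l' -> L (fun x => a * l x + l' x)) ->
    (forall x, x != 0 -> exists2 l, L l & l x != 0) ->
  forall m (w : 'I_m -> V) f, ~ linspan w f ->
  exists2 l, L l & l f != 0 /\ forall i, l (w i) = 0.
Proof.
move=> Llin Lcomb Lsep.
have Lspan m (w : 'I_m -> V) l x : L l -> (forall i, l (w i) = 0) ->
    linspan w x -> l x = 0.
  move=> /Llin ll lw [c ->]; have l0 : l 0 = 0.
    by have := ll (-1) 0 0; rewrite scaler0 addr0 mulN1r addNr.
  by elim/big_ind: _ => // [y z y0 z0|i _];
    [rewrite -[y]scale1r ll mul1r y0 z0 addr0|
     rewrite -[_ *: _]addr0 ll lw mulr0 l0 addr0].
elim=> [|m IH] w f.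
  move=> f0; have [|l Ll lf] := Lsep f; last by exists l => //; split=> // -[].
  by apply: contra_notN f0 => /eqP ->; exact: (linspan_subspace w).1.
set w' := w \o lift ord0 => fw.
have kill l : l (w ord0) = 0 -> (forall i, l (w' i) = 0) ->
  forall i, l (w i) = 0.
  by move=> l0 lw' i; case: (unliftP ord0 i) => [j ->|->]; [exact: lw'|].
have [w0|/IH[l1 Ll1 [l1w0 l1w']]] := pselect (linspan w' (w ord0)).
  have [|l Ll [lf lw']] := IH w' f.
    by move=> h; apply: fw; apply/linspan_recl; exists 0; rewrite scale0r subr0.
  by exists l => //; split=> //; apply: kill => //; exact: (Lspan _ w').
pose a := l1 f / l1 (w ord0).
have [|l2 Ll2 [l2f l2w']] := IH w' (f - a *: w ord0).
  by move=> h; apply: fw; apply/linspan_recl; exists a.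
have := Lcomb (- (l2 (w ord0) / l1 (w ord0))) _ _ Ll1 Ll2.
set l := (X in L X) => Ll; exists l => //; split; last first.
  apply: kill => [|i]; first by rewrite /l mulNr divfK ?addNr.
  by rewrite /l l1w' l2w' mulr0 addr0.
apply: contraNneq l2f => lf0; apply/eqP; rewrite -lf0 /l.
rewrite [f - _]addrC -scaleNr (Llin _ Ll2) /a; congr (_ + _); ring.
Qed.

End Linspan.

Section FiniteDimClosed.
Variables (R : realType) (H : hilbertSpace R).
Local Notation C := R[i].

(* Norm-continuous functionals such as [f |-> <f x, y>] separate the points of
   B(H), hence separate a point from a finite-dimensional subspace. *)
Lemma linspan_opnorm_closed m (w : 'I_m -> (H -> H)) :
  opnorm_closed (linspan w).
Proof.
move=> f _ fw; apply: contrapT.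
pose L : set ((H -> H) -> C) := [set l | scalar l /\ exists2 k : C, 0 <= k &
  forall (g : H -> H) e, 0 <= e -> (forall x, `|g x| <= e * `|x|) ->
  `|l g| <= k * e].
move=> /(@separate_from_linspan _ _ L)[].
- by move=> l [].
- move=> a l l' [ll [k k0 lk]] [ll' [k' k'0 lk']]; split.
    by move=> b x y; rewrite ll ll'; ring.
  exists (`|a| * k + k') => [|g e e0 ge]; first by rewrite addr_ge0 ?mulr_ge0.
  apply: le_trans (ler_normD _ _) _.
  by rewrite mulrDl lerD ?lk'// normrM -mulrA ler_wpM2l ?lk.
- move=> g /eqP g0; have [x gx] : exists x, g x <> 0.
    by apply: contrapT => /forallNP h; apply: g0; apply/funext => x;
      exact: contrapT.
  exists (fun h => hs_dot (h x) (g x)); last by apply/eqP => /hs_dot_eq0.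
  split=> [a h h'|]; first by rewrite op_linE hs_dotPl.
  exists (`|x| * `|g x|) => [|h e e0 he]; first by rewrite mulr_ge0.
  apply: le_trans (hs_dot_le _ _) _.
  by rewrite -mulrA [_ * e]mulrC mulrA [`|x| * e]mulrC ler_wpM2r.
move=> l [ll [k k0 lk]] [lf lw].
have lspan g : linspan w g -> l g = 0.
  move=> [c ->]; have l0 : l 0 = 0.
    by have := ll (-1) 0 0; rewrite scaler0 addr0 mulN1r addNr.
  by elim/big_ind: _ => // [y z y0 z0|i _];
    [rewrite -[y]scale1r ll mul1r y0 z0 addr0|
     rewrite -[_ *: _]addr0 ll lw mulr0 l0 addr0].
(* This makes [k * e] smaller than the norm of [l f], whereas an element of the span within [e] of
   [f] would force the opposite inequality; [k + 1] allows [k = 0]. *)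
pose e := `|l f| / (2 * (k + 1)).
have k1 : 0 < k + 1 by rewrite ltr_wpDl.
have e0 : 0 < e by rewrite divr_gt0 ?normr_gt0// mulr_gt0.
have [g wg fg] := fw e e0.
have := lk (f - g) e (ltW e0) fg.
rewrite addrC -scaleN1r ll (lspan _ wg) mulr0 add0r.
apply/negP; rewrite -real_ltNge ?realM ?normr_real ?ger0_real ?(ltW e0)//.
rewrite /e mulrA ltr_pdivrMr ?mulr_gt0//.
rewrite mulrC ltr_pM2l ?normr_gt0// mulrDr mulr1 (le_lt_trans (y := k + k))//.
  by rewrite lerDl.
  by rewrite mulr_natl mulr2n ltrDl.
by rewrite invr_ge0 mulr_ge0// ltW.
Qed.

End FiniteDimClosed.

(** * Alternating words *)

Section Antisymmetric.
Variables (K : fieldType) (W : lmodType K) (S : set W).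
Hypotheses (two_neq0 : 2 != 0 :> K) (SS : subspace S).

(** Each adjacent transposition changes the sign modulo [S], and membership in [S] ignores signs.
    The head of [s'] is moved to the front of [s] by such transpositions; the prefix [p] holds the
    letters already in place. *)
Lemma antisym_mod_perm (T : eqType) (f : seq T -> W) m :
  (forall p a d r, size (p ++ [:: a, d & r]) = m ->
     S (f (p ++ [:: a, d & r]) + f (p ++ [:: d, a & r]))) ->
  forall s s', perm_eq s s' -> size s = m -> S (f s) -> S (f s').
Proof.
move=> swap; suff perm_tail s' p s : perm_eq s s' -> size (p ++ s) = m ->
    S (f (p ++ s)) -> S (f (p ++ s')) by move=> s s';
      exact: (perm_tail s' [::]).
elim: s' p s => [|a s' IH] p s ss'.
  by move/perm_size/size0nil: ss' => ->.
have a_s : a \in s by rewrite (perm_mem ss') mem_head.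
case/splitPr: a_s ss' => s1 s2; rewrite -cat1s perm_catCA perm_cons => ss' sz.
suff front t : size (p ++ s1 ++ a :: t) = m -> S (f (p ++ s1 ++ a :: t)) ->
    S (f (p ++ a :: s1 ++ t)).
  move=> /(front _ sz) h; rewrite -cat_rcons; apply: (IH _ _ ss').
    by rewrite -sz -cats1 !size_cat /=; lia.
  by rewrite cat_rcons.
elim/last_ind: s1 t {ss' sz} => [|s1 b IHs] t sz //.
rewrite cat_rcons => h; have sz' : size ((p ++ s1) ++ [:: b, a & t]) = m.
  by rewrite -sz !size_cat size_rcons /=; lia.
rewrite cat_rcons; apply: IHs; first by rewrite -sz' !size_cat /=; lia.
by have := subspaceB SS (swap _ _ _ _ sz') h;
  rewrite catA -catA addrAC subrr add0r catA.
Qed.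

(** A word without repetition is a rearrangement of an enumerated set. In any other word two equal
    letters can be brought together, where the swap hypothesis puts twice the value in [S]; hence
    [two_neq0]. *)
Lemma antisym_mod_span (T : finType) (f : seq T -> W) m :
  (forall p a d r, size (p ++ [:: a, d & r]) = m ->
     S (f (p ++ [:: a, d & r]) + f (p ++ [:: d, a & r]))) ->
  (forall I : {set T}, #|I| = m -> S (f (enum I))) ->
  forall s, size s = m -> S (f s).
Proof.
move=> swap enumS s sz; have [us|] := boolP (uniq s).
  have es : perm_eq (enum [set x in s]) s.
    by apply: uniq_perm; rewrite ?enum_uniq// => x; rewrite mem_enum inE.
  apply: (antisym_mod_perm swap es); rewrite ?(perm_size es)//.
  by apply: enumS; rewrite cardE (perm_size es).
move=> nus; have [a [r sar]] : exists a r, perm_eq s [:: a, a & r].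
  elim: s nus {sz} => //= a s IH; rewrite negb_and negbK.
  have [a_s _|_ /= /IH[b [r sbr]]] := boolP (a \in s).
    by exists a, (rem a s); rewrite perm_cons perm_to_rem.
  exists b, (a :: r); rewrite -(perm_cons a) in sbr; apply: perm_trans sbr _.
  by rewrite (perm_catCA [:: a] [:: b; b]).
have sz' : size ([::] ++ [:: a, a & r]) = m by rewrite -sz (perm_size sar).
rewrite perm_sym in sar; apply: (antisym_mod_perm swap sar) => //.
have := subspaceZ 2^-1 SS (swap _ _ _ _ sz').
by rewrite -mulr2n -scaler_nat scalerA mulVf// scale1r.
Qed.

End Antisymmetric.

(** The surplus tail of the longer list is dropped, so no letter is lost only if [s] is as long as
    [t] or one letter longer. *)
Fixpoint interleave (T : Type) (s t : seq T) :=
  if s is i :: s' then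
    i :: (if t is j :: t' then j :: interleave s' t' else [::])
  else [::].

Section Interleave.
Variable T : Type.
Implicit Types s t p q : seq T.

Lemma interleave_cons i s t : interleave (i :: s) t = i :: interleave t s.
Proof.
elim: s i t => [|k s IH] i [|j t] //=; congr [:: _, _ & _].
by move: (IH k t) => /=.
Qed.

Lemma interleave_cat p q s t : size p = size q ->
  interleave (p ++ s) (q ++ t) = interleave p q ++ interleave s t.
Proof. by elim: p q => [|i p IH] [|j q] //= [/IH ->]. Qed.

Lemma size_interleave s t : (size t <= size s <= (size t).+1)%N ->
  size (interleave s t) = (size s + size t)%N.
Proof. by elim: s t => [|i s IH] [|j t] //= h; rewrite ?IH //; lia. Qed.

Lemma interleaveP l : exists s t, [/\ l = interleave s t,
  size s = (size t + odd (size l))%N & size l = (size s + size t)%N].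
Proof.
elim: l => [|i l [s [t [-> st szl]]]]; first by exists [::], [::].
exists (i :: t), s; rewrite interleave_cons; split=> //=; last by rewrite szl;
  lia.
by rewrite st; case: odd => /=; lia.
Qed.

End Interleave.

Section Words.
Variables (K : fieldType) (V : lmodType K) (n : nat).
Variable L : bool -> 'I_n -> V -> V.
Hypotheses (two_neq0 : 2 != 0 :> K) (Llin : forall b i, linear (L b i)).

(* In the application [L false i] is [u_i] and [L true i] is its adjoint. *)
Fixpoint word (b : bool) (l : seq 'I_n) : V -> V :=
  if l is i :: l' then L b i \o word (~~ b) l' else id.

Lemma word_cat b s t :
  word b (s ++ t) = word b s \o word (odd (size s) (+) b) t.
Proof.
by elim: s b => //= i s IH b; rewrite IH /= addbN -addNb.
Qed.

Lemma word_linear b l : linear (word b l).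
Proof. by elim: l b => [|i l IH] b a x y //=; rewrite IH Llin. Qed.

Hypothesis Lrel : forall b a c d,
  (L b a \o L (~~ b) c \o L b d) + (L b d \o L (~~ b) c \o L b a) =
  (a == c)%:R *: L b d + (c == d)%:R *: L b a.

(** The grid relation in context: letters two places apart, hence of the same kind, anticommute
    modulo words shorter by two. *)
Lemma word_swap b x a c d y :
  word b (x ++ [:: a, c, d & y]) + word b (x ++ [:: d, c, a & y]) =
  (a == c)%:R *: word b (x ++ d :: y) + (c == d)%:R *: word b (x ++ a :: y).
Proof.
rewrite !word_cat; set b' := odd _ (+) b; apply/funext => v /=.
have lw := word_linear b x.
have lwD u w : word b x (u + w) = word b x u + word b x w.
  by have := lw 1 u w; rewrite !scale1r.
have lw0 : word b x 0 = 0 by have := lw (-1) 0 0; rewrite !scaleN1r !addNr.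
have lwZ k u : word b x (k *: u) = k *: word b x u.
  by have := lw k u 0; rewrite lw0 !addr0.
rewrite negbK; set q := word (~~ b') y v.
have E : L b' a (L (~~ b') c (L b' d q)) + L b' d (L (~~ b') c (L b' a q)) =
         (a == c)%:R *: L b' d q + (c == d)%:R *: L b' a q.
  exact: (congr1 (fun f : V -> V => f q) (Lrel b' a c d)).
transitivity ((a == c)%:R *: word b x (L b' d q) +
              (c == d)%:R *: word b x (L b' a q)); last by [].
by rewrite -!lwZ -lwD -E lwD.
Qed.

(** By strong induction on the length, all shorter odd words lie in [S], so [word_swap] becomes
    antisymmetry modulo [S]. [antisym_mod_span] then sorts the letters at even places, and after
    that those at odd places. *)
Lemma words_span (S : set (V -> V)) : subspace S ->
  (forall I J : {set 'I_n}, #|I| = #|J|.+1 ->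
     S (word false (interleave (enum I) (enum J)))) ->
  forall l, odd (size l) -> S (word false l).
Proof.
move=> SS enumS l; elim/ltn_ind: {l}(size l) {-2}l (erefl (size l)) =>
  m IH l szl ol.
have [s [t [el st szst]]] := interleaveP l.
rewrite ol addn1 in st; rewrite szl in szst; rewrite {}el {szl ol}.
have low l' : odd (size l') -> (size l' < m)%N -> S (word false l').
  by move=> ol' ml'; exact: (IH _ ml').
have lowP (a c : bool) l1 l2 : (odd (size l1) && (size l1 < m))%N ->
    (odd (size l2) && (size l2 < m))%N ->
    S (a%:R *: word false l1 + c%:R *: word false l2).
  by move=> /andP[? ?] /andP[? ?]; apply: subspaceD => //;
    apply: subspaceZ => //; exact: low.
have split_at (r : seq 'I_n) k : (k < size r)%N ->
    exists p c q, r = p ++ c :: q /\ size p = k.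
  move=> kr; exists (take k r); case: r kr => // r0 r kr.
  exists (nth r0 (r0 :: r) k), (drop k.+1 (r0 :: r)).
  by rewrite -drop_nth// cat_take_drop size_takel// ltnW.
(* Neighbours [a] and [d] of the first list are separated in the word by the letter [c] of [t'] at
   position [size p]. *)
have swap_l t' : size t' = size t -> forall p a d r,
    size (p ++ [:: a, d & r]) = (size t).+1 ->
    S (word false (interleave (p ++ [:: a, d & r]) t') +
       word false (interleave (p ++ [:: d, a & r]) t')).
  move=> st' p a d r; rewrite size_cat /= => sz.
  have [|x [c [q [et' sx]]]] := split_at t' (size p); first by lia.
  move: st'; rewrite {}et' size_cat /= => st'.
  rewrite !interleave_cat// !interleave_cons word_swap.
  by apply: lowP; rewrite !size_cat /= !size_interleave; lia.
(* Once the initial letter [x0] is peeled off, the two lists exchange roles and the same argument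
   applies. *)
have swap_r s' : size s' = size s -> forall p a d r,
    size (p ++ [:: a, d & r]) = size t ->
    S (word false (interleave s' (p ++ [:: a, d & r])) +
       word false (interleave s' (p ++ [:: d, a & r]))).
  case: s' => [|x0 s']; first by rewrite st.
  rewrite st => -[st'] p a d r; rewrite size_cat => sz; rewrite /= in sz.
  have [|x [c [q [es' sx]]]] := split_at s' (size p); first by lia.
  move: st'; rewrite {}es' size_cat => st'; rewrite /= in st'.
  rewrite !interleave_cons !interleave_cat//
    !interleave_cons -!cat_cons word_swap.
  by apply: lowP; rewrite !size_cat /= !size_interleave; lia.
pose g r := word false (interleave r t); rewrite -[X in S X]/(g s).
apply: (antisym_mod_span (f := g) two_neq0 SS (swap_l t erefl)) => [I cI|//].
pose f r := word false (interleave (enum I) r).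
have cIs : size (enum I) = size s by rewrite -cardE cI st.
rewrite -[X in S X]/(f t).
apply: (antisym_mod_span (f := f) two_neq0 SS (swap_r _ cIs)) => [J cJ|//].
by apply: enumS; rewrite cI cJ.
Qed.

End Words.

(** * Creation operators *)

Section LinearOnEll2.
Variables (R : realType) (I : finType).
Local Notation H := (ell2_hilbert R I).

Lemma ell2_linear_bounded (f : H -> H) : linear f -> bounded_op f.
Proof.
move=> fl; split=> //.
pose F : {linear H -> H} := HB.pack f (GRing.isLinear.Build _ _ _ _ f fl).
apply: (@bounded_linear_continuous _ _ _ F); apply/bounded_funP => r.
exists (r * \sum_i `|f (ell2_basis R i)|) => x xr.
rewrite {1}[x]ell2_sum_basis [F _]linear_sum.
apply: le_trans (ler_norm_sum _ _ _) _; rewrite mulr_sumr;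
  apply: ler_sum => i _.
rewrite linearZ normrZ ler_wpM2r//.
exact: le_trans (ell2_coord_le _ _) xr.
Qed.

End LinearOnEll2.

Section Fock.
Variables (R : realType) (n : nat).
Local Notation C := R[i].
Local Notation F := (ell2 R {set 'I_n}).
Local Notation H := (ell2_hilbert R {set 'I_n}).
Implicit Types (i j k : 'I_n) (S T : {set 'I_n}) (x y : F).

(* [ell2_basis S] stands for the wedge of the [e_s], [s] increasing in [S]. *)
Definition fsign i S : C := (-1) ^+ #|[set j in S | (j < i)%N]|.

(** Exterior multiplication by e_i: the coefficient at [S] comes from [S :\ i], with the sign of
    moving e_i past the smaller elements. [annihilate] is the contraction adjoint to it. *)
Definition create i x : F :=
  [ffun S : {set 'I_n} => if i \in S then fsign i S * x (S :\ i) else 0].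

Definition annihilate i x : F :=
  [ffun S : {set 'I_n} => if i \in S then 0 else fsign i S * x (i |: S)].

Lemma fsign_sqr i S : fsign i S * fsign i S = 1.
Proof. by rewrite -expr2 sqrr_sign. Qed.

Lemma fsign_conj i S : (fsign i S)^*%C = fsign i S.
Proof. by rewrite rmorphXn rmorphN rmorph1. Qed.

Lemma fsignU1 i j S : j \notin S ->
  fsign i (j |: S) = (-1) ^+ (j < i)%N * fsign i S.
Proof.
move=> jS; rewrite /fsign -exprD; congr (_ ^+ _).
have [ji|ij] := boolP (j < i)%N; last first.
  rewrite add0n; congr #|pred_of_set _|; apply/setP => k; rewrite !inE.
  by have [->|//] := eqVneq k j; rewrite (negPf ij) !andbF.
rewrite [RHS]addnC addn1 (cardsD1 j) !inE eqxx ji /= add1n; congr _.+1.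
congr #|pred_of_set _|; apply/setP => k; rewrite !inE.
by have [->|//] := eqVneq k j; rewrite (negPf jS).
Qed.

Lemma fsignD1 i j S : j \in S ->
  fsign i (S :\ j) = (-1) ^+ (j < i)%N * fsign i S.
Proof.
move=> jS; rewrite -[S in RHS](finset.setD1K jS) fsignU1 ?inE ?eqxx//.
by rewrite mulrA -expr2 sqrr_sign mul1r.
Qed.

(** Source of the minus sign in both anticommutation relations: adding or removing the smaller index
    affects the sign of the larger one, but not conversely. *)
Lemma fsign_anti i j : i != j -> (-1) ^+ (i < j)%N = - (-1) ^+ (j < i)%N :> C.
Proof.
by rewrite -(inj_eq val_inj); case: ltngtP => //= _ _;
  rewrite ?expr1 ?expr0 ?opprK.
Qed.

Lemma create_linear i : linear (create i).
Proof.
move=> a x y; apply/ffunP => S; rewrite !(ell2_scaleE, ffunE).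
by case: ifP => _; rewrite ?mulr0 ?addr0// mulrDr mulrCA.
Qed.

Lemma annihilate_linear i : linear (annihilate i).
Proof.
move=> a x y; apply/ffunP => S; rewrite !(ell2_scaleE, ffunE).
by case: ifP => _; rewrite ?mulr0 ?addr0// mulrDr mulrCA.
Qed.

Lemma create_create i j x : create i (create j x) = - create j (create i x).
Proof.
apply/ffunP => S; rewrite !ffunE !inE.
have [->|ij] := eqVneq i j; first by case: ifP => _; rewrite ?mulr0 oppr0.
rewrite /=; case: ifP => iS; case: ifP => jS; rewrite ?mulr0 ?oppr0//.
rewrite !fsignD1// (fsign_anti ij) finset.setDDl finset.setDDl finset.setUC;
  ring.
Qed.

(** The canonical anticommutation relation, oriented so as to move annihilators to the left. *)
Lemma create_annihilate i j x :
  create i (annihilate j x) = (i == j)%:R *: x - annihilate j (create i x).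
Proof.
apply/ffunP => S; rewrite !ffunE !inE.
have [->|ij] := eqVneq i j.
  rewrite /= scale1r; case: ifP => jS; last first.
    rewrite finset.setU1K ?jS// mulrA fsignU1 ?jS// ltnn mul1r fsign_sqr mul1r.
    by rewrite subrr.
  by rewrite finset.setD1K// mulrA fsignD1// ltnn mul1r fsign_sqr mul1r subr0.
rewrite /= scale0r.
case: ifP => iS; case: ifP => jS; rewrite ?mulr0 ?subr0 ?sub0r ?oppr0//.
rewrite fsignD1// fsignU1 ?jS// (fsign_anti ij).
rewrite [j |: _](_ : _ = (j |: S) :\ i); first by ring.
by apply/setP => k; rewrite !inE; have [->|//] := eqVneq k j;
  rewrite eq_sym (negPf ij).
Qed.

Lemma create_annihilate_adjoints i :
  adjoints (create i : H -> H) (annihilate i).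
Proof.
split=> [||x y].
- exact/ell2_linear_bounded/create_linear.
- exact/ell2_linear_bounded/annihilate_linear.
rewrite -[LHS]/(\sum_S create i x S * (y S)^*%C).
rewrite -[RHS]/(\sum_S x S * (annihilate i y S)^*%C).
rewrite (bigID (fun S => i \in S)) /= [X in _ + X]big1 ?addr0; last first.
  by move=> S /negPf iS; rewrite ffunE iS mul0r.
rewrite [RHS](bigID (fun S => i \notin S)) /= [X in _ = _ + X]big1 ?addr0;
  last first.
  by move=> S; rewrite negbK => iS; rewrite ffunE iS rmorph0 mulr0.
(* The left sum lives on the sets containing [i], the right one on the sets avoiding [i]; adjoining
   [i] matches them. *)
rewrite (reindex_onto (fun S => i |: S) (fun S => S :\ i)) /=; last first.
  by move=> S iS; rewrite finset.setD1K.
apply: eq_big => [S|S]; rewrite finset.setU11 /=.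
  apply/eqP/idP => [<-|iS]; first by rewrite finset.setD11.
  by rewrite finset.setU1K.
move=> /eqP SE; have iS : i \notin S by rewrite -SE finset.setD11.
rewrite !ffunE finset.setU11 (negPf iS) rmorphM /= fsign_conj finset.setU1K//
  fsignU1// ltnn; ring.
Qed.

(** With [annihilate j] moved to the left in both products, the remaining terms cancel since
    [create i] and [create k] anticommute. *)
Lemma create_rel i j k x :
  create i (annihilate j (create k x)) + create k (annihilate j (create i x)) =
  (i == j)%:R *: create k x + (j == k)%:R *: create i x.
Proof.
rewrite !create_annihilate [create i (create k x)]create_create.
rewrite -[- create k _]scaleN1r -[_ *: create k (create i x)]addr0.
have a0 : annihilate j 0 = 0.
  by have := annihilate_linear j (-1) 0 0; rewrite !scaleN1r !addNr.
rewrite annihilate_linear a0 addr0 scaleN1r opprK [k == j]eq_sym.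
by rewrite addrACA subrr addr0.
Qed.

Definition munit S T x : F := [ffun U : {set 'I_n} => (U == S)%:R * x T].

Lemma munit_coef S T S' T' :
  munit S T (ell2_basis R T') S' = ((S' == S) && (T == T'))%:R.
Proof. by rewrite !ffunE -mulnb natrM. Qed.

Lemma create_basis_grade i T S : #|S| != #|T|.+1 ->
  create i (ell2_basis R T) S = 0.
Proof.
move=> ST; rewrite !ffunE; case: ifP => // iS.
case: eqP => [E|_]; last by rewrite mulr0.
by rewrite (cardsD1 i) iS E eqxx in ST.
Qed.

Section Generation.
(** [M] will be the image of the enveloping TRO. Of its ternary structure only left multiplication
    by [u_i u_j^*] is needed, which is [M_hop]. *)
Variable M : set (F -> F).
Hypotheses (MS : subspace M) (M_create : forall i, M (create i)).
Hypothesis M_hop : forall i j X, M X -> M (create i \o annihilate j \o X).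

(* Left multiplication by [create k \o annihilate k] selects the rows indexed by
   sets containing [k]. *)
Lemma generate_filtered i S (l : seq 'I_n) :
  M (fun x => [ffun U : {set 'I_n} =>
       (all (fun k => (k \in U) == (k \in S)) l)%:R * create i x U] : F).
Proof.
elim: l => [|k l IH].
  have -> : (fun x => [ffun U : {set 'I_n} =>
      (all (fun k => (k \in U) == (k \in S)) [::])%:R * create i x U] : F) =
      create i => //.
  by apply/funext => x; apply/ffunP => U; rewrite ffunE mul1r.
set X := (X in M X) in IH.
have pX x U : (create k (annihilate k (X x))) U = (k \in U)%:R * X x U.
  rewrite !ffunE finset.setD11; case: ifP => kU; last by rewrite mul0r.
  by rewrite finset.setD1K// mulrA fsignD1// ltnn mul1r fsign_sqr.
have [kS|kS] := boolP (k \in S).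
  have := M_hop k k IH; congr M; apply/funext => x; apply/ffunP => U.
  rewrite [LHS]pX !ffunE /= kS eqb_id; case: (k \in U);
    rewrite /= ?mul1r ?mul0r//.
(* Subtracting the selected rows leaves those indexed by sets without [k]. *)
have := subspaceB MS IH (M_hop k k IH); congr M; apply/funext => x; apply/ffunP
  => U.
have subE (y z : F) : (y - z) U = y U - z U by rewrite !ffunE.
rewrite [LHS]subE pX.
rewrite !ffunE /= (negPf kS) eqbF_neg.
by case: (k \in U); rewrite /= ?mul1r ?mul0r ?subrr ?subr0.
Qed.

(* If [S] contains [T] then [munit S T] is, up to sign, a row of a creation
   operator; the other rows are reached by moving elements of [S] one by one. *)
Lemma generate_munit S T : #|S| = #|T|.+1 -> M (munit S T).
Proof.
have [m] := ubnP #|S :\: T|; elim: m S => // m IH S /ltnSE-leSTm cST.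
have [i iS iT] : exists2 i, i \in S & i \notin T.
  by apply/subsetPn; apply: contraL (leqnn #|T|) => /subset_leq_card;
    rewrite cST -ltnNge.
have [TS|/subsetPn[j jT jS]] := boolP (T \subset S).
  have TE : S :\ i = T.
    apply/eqP; rewrite eq_sym eqEcard; apply/andP; split.
      by apply/subsetD1P.
    by move: cST; rewrite (cardsD1 i S) iS; lia.
  (* Filtering by every element of ['I_n] leaves the single row [S] of [create i]; its only entry is
     [fsign i S], in column [T], and the scalar cancels it. *)
  have := subspaceZ (fsign i S) MS (generate_filtered i S (enum 'I_n)).
  congr M; apply/funext => x; apply/ffunP => U.
  rewrite [LHS]ell2_scaleE !ffunE; have [->|US] := eqVneq U S.
    rewrite iS TE (_ : all _ _) ?mul1r ?mulrA ?fsign_sqr ?mul1r//.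
    by apply/allP => k _.
  rewrite (_ : all _ _ = false) ?mul0r ?mulr0//.
  apply: contraNF US => /allP SU; apply/eqP/setP => k.
  by apply/eqP; apply: SU; rewrite mem_enum.
have ij : i != j by apply: contraNneq iT => ->.
(* [S1] trades an element outside [T] for one of [T], so it is closer to [T];
   [create i \o annihilate j] moves row [S1] back to row [S], up to sign. *)
pose S1 := j |: (S :\ i).
have jSi : j \notin S :\ i by rewrite !inE (negPf jS) andbF.
have cS1 : #|S1| = #|S| by rewrite cardsU1 jSi (cardsD1 i S) iS.
have S1T : (#|S1 :\: T| < m)%N.
  apply: leq_trans leSTm; rewrite [X in (_ < X)%N](cardsD1 i) !inE iS iT ltnS.
  apply: subset_leq_card; apply/fintype.subsetP => k; rewrite !inE.
  by case/andP => kT /orP[/eqP kj|/andP[-> ->]];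
    [rewrite kj jT in kT|rewrite kT].
have := IH S1 S1T; rewrite cS1 => /(_ cST) /(M_hop i j).
move=> /(subspaceZ (fsign i S * fsign j (S :\ i)) MS).
congr M; apply/funext => x; apply/ffunP => U.
rewrite [LHS]ell2_scaleE !ffunE; have [->|US] := eqVneq U S.
  rewrite iS (negPf jSi) /S1 eqxx mul1r.
  rewrite -[RHS]mul1r -[1](fsign_sqr i S) -[x T in RHS]mul1r.
  rewrite -[1](fsign_sqr j (S :\ i)); ring.
case: ifP => iU; last by rewrite mulr0 mul0r.
case: ifP => jU; first by rewrite !mulr0 mul0r.
rewrite (_ : (_ == S1) = false) ?mul0r ?mulr0//.
apply: contraNF US => /eqP E; apply/eqP.
rewrite -(finset.setD1K iU) -(finset.setD1K iS); congr (_ |: _).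
by rewrite -(finset.setU1K (negbT jU)) E finset.setU1K.
Qed.

End Generation.

End Fock.

(** * Ternary products of linear combinations *)

Section TernarySums.
Variables (R : realType) (V : lmodType R[i]) (m : V -> V -> V -> V).
Local Notation C := R[i].

(* On [E] the product behaves like [x y^* z]. *)
Definition sesqui_ternary (E : set V) :=
  forall (a : C) x x' y z, E x -> E x' -> E y -> E z ->
  [/\ m (a *: x + x') y z = a *: m x y z + m x' y z,
      m y (a *: x + x') z = a^*%C *: m y x z + m y x' z &
      m y z (a *: x + x') = a *: m y z x + m y z x'].

Variables (E : set V) (E_subspace : subspace E) (m_sesqui : sesqui_ternary E).

(** Treats the linear and conjugate-linear slots together: [s] is [id] or [conjc], and its value at
    [-1] yields [g 0 = 0]. *)
Let sum_scale (N : nat) (g : V -> V) (s : C -> C) (a : 'I_N -> C)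
    (w : 'I_N -> V) :
  (s 0 = 0) -> (forall i, E (w i)) ->
  (forall a x x', E x -> E x' -> g (a *: x + x') = s a *: g x + g x') ->
  s (-1) = -1 ->
  g (\sum_i a i *: w i) = \sum_i s (a i) *: g (w i).
Proof.
move=> s0 Ew gP sN1; have g0 : g 0 = 0.
  have E0 := E_subspace.1; have := gP (-1) 0 0 E0 E0.
  by rewrite sN1 !scaleN1r !addNr.
elim: N a w Ew => [|N IH] a w Ew; first by rewrite !big_ord0.
rewrite !big_ord_recl gP ?IH//.
by apply: subspace_sum.
Qed.

Lemma ternary_sum (N : nat) (a b d : 'I_N -> C) (w : 'I_N -> V) :
  (forall i, E (w i)) ->
  m (\sum_i a i *: w i) (\sum_j b j *: w j) (\sum_k d k *: w k) =
  \sum_i \sum_j \sum_k (a i * (b j)^*%C * d k) *: m (w i) (w j) (w k).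
Proof.
move=> Ew; have ES (c : 'I_N -> C) : E (\sum_i c i *: w i) by exact:
  subspace_sum.
rewrite (@sum_scale _ (fun x => m x _ _) id)//; last first.
  by move=> c x x' Ex Ex'; case: (m_sesqui c Ex Ex' (ES b) (ES d)).
apply: eq_bigr => i _.
rewrite (@sum_scale _ (fun x => m (w i) x _) (@conjc R)) ?rmorph0 ?rmorphN1//;
  last first.
  by move=> c x x' Ex Ex'; case: (m_sesqui c Ex Ex' (Ew i) (ES d)).
rewrite scaler_sumr; apply: eq_bigr => j _.
rewrite (@sum_scale _ (fun x => m (w i) (w j) x) id)//; last first.
  by move=> c x x' Ex Ex'; case: (m_sesqui c Ex Ex' (Ew i) (Ew j)).
rewrite !scaler_sumr; apply: eq_bigr => k _.
by rewrite !scalerA ?mulrA.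
Qed.

Lemma ternary_sum_subspace (N : nat) (w : 'I_N -> V) x y z :
  (forall i, E (w i)) -> (forall i j k, linspan w (m (w i) (w j) (w k))) ->
  linspan w x -> linspan w y -> linspan w z -> linspan w (m x y z).
Proof.
move=> Ew wm [a ->] [b ->] [d ->]; rewrite ternary_sum//.
have [w0 _] := linspan_subspace w; have wD := subspaceD (linspan_subspace w).
do 3![elim/big_ind: _ => //= ? _].
by apply: subspaceZ; [exact: linspan_subspace|exact: wm].
Qed.

(** The span is a Hilbert-type triple, with the product [(<x,y> z + <z,y> x) / 2] and [w] as
    orthonormal family. The scalars depend on coefficients alone, so the formula transfers from one
    grid to another. *)
Lemma jordan_sum (N : nat) (a b d : 'I_N -> C) (w : 'I_N -> V) :
  (forall i, E (w i)) ->
  (forall i j k, jordan m (w i) (w j) (w k) =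
     2^-1 *: ((i == j)%:R *: w k + (j == k)%:R *: w i)) ->
  jordan m (\sum_i a i *: w i) (\sum_j b j *: w j) (\sum_k d k *: w k) =
  2^-1 *: ((\sum_i a i * (b i)^*%C) *: (\sum_k d k *: w k) +
           (\sum_i d i * (b i)^*%C) *: (\sum_i a i *: w i)).
Proof.
move=> Ew rel; rewrite {1}/jordan !ternary_sum//; congr (_ *: _).
have exch3 (G : 'I_N -> 'I_N -> 'I_N -> V) :
    \sum_i \sum_j \sum_k G i j k = \sum_k \sum_j \sum_i G i j k.
  rewrite exchange_big /=; under eq_bigr do rewrite exchange_big /=.
  by rewrite exchange_big.
rewrite [X in _ + X]exch3 -big_split /=.
have relE i j k : m (w i) (w j) (w k) + m (w k) (w j) (w i) =
    (i == j)%:R *: w k + (j == k)%:R *: w i.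
  by apply: (@scalerI _ _ (2^-1 : C)); [rewrite invr_eq0 pnatr_eq0|exact: rel].
transitivity (\sum_i \sum_j \sum_k
    ((i == j)%:R *: ((a i * (b j)^*%C * d k) *: w k) +
     (j == k)%:R *: ((a i * (b j)^*%C * d k) *: w i))).
  apply: eq_bigr => i _; rewrite -big_split; apply: eq_bigr => j _ /=.
  rewrite -big_split; apply: eq_bigr => k _ /=.
  rewrite [d k * _ * _]mulrC [d k * _]mulrC mulrA -scalerDr relE scalerDr.
  by rewrite !scalerA ![_%:R * _]mulrC.
have delta_sum (G : 'I_N -> V) i : \sum_j (i == j)%:R *: G j = G i.
  by under eq_bigr do rewrite eq_sym; exact: sum_delta.
transitivity (\sum_i (\sum_k (a i * (b i)^*%C * d k) *: w k +
                      \sum_j (a i * (b j)^*%C * d j) *: w i)).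
  apply: eq_bigr => i _.
  transitivity (\sum_j ((i == j)%:R *: (\sum_k (a i * (b j)^*%C * d k) *: w k) +
                        (a i * (b j)^*%C * d j) *: w i)).
    by apply: eq_bigr => j _; rewrite big_split /= delta_sum -scaler_sumr.
  by rewrite big_split /= delta_sum.
rewrite big_split /= !scaler_suml; congr (_ + _).
  by apply: eq_bigr => i _; rewrite scaler_sumr; apply: eq_bigr => k _;
    rewrite scalerA.
rewrite exchange_big; apply: eq_bigr => j _; rewrite scaler_sumr.
by apply: eq_bigr => i _; rewrite scalerA; congr (_ *: _); ring.
Qed.

End TernarySums.

Section OperatorTernary.
Variables (R : realType) (H : hilbertSpace R).
Local Notation C := R[i].

(** The domain on which [adjoint] is a genuine adjoint rather than its default [0], so that
    [op_tern] is conjugate-linear in the middle. *)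
Definition adjointable : set (H -> H) := [set f | adjoints f (adjoint f)].

Lemma adjointableP f g : adjoints f g -> adjointable f.
Proof. by move=> fg; rewrite /adjointable /= (adjointE fg). Qed.

Lemma adjointable_subspace : subspace adjointable.
Proof.
split; first exact: adjointableP (adjoints0 H).
by move=> a f g fa ga; exact: adjointableP (adjoints_lin a fa ga).
Qed.

Lemma op_tern_sesqui : sesqui_ternary (@op_tern R H) adjointable.
Proof.
move=> a f f' g h fa f'a ga ha; rewrite /op_tern; split; apply/funext => x.
- by [].
- have [[gl _] _ _] := ga.
  by rewrite (adjointE (adjoints_lin a fa f'a)) [RHS]op_linE /= op_linE gl.
- have [[gl _] _ _] := ga; have [hl _] := adjoint_bounded h.
  by rewrite [RHS]op_linE /= op_linE hl gl.
Qed.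

Lemma op_tern_rel (f g h : H -> H) (a b : C) :
  jordan (@op_tern R H) f g h = 2^-1 *: (a *: h + b *: f) ->
  (f \o adjoint g \o h) + (h \o adjoint g \o f) = a *: h + b *: f.
Proof.
move=> E; apply: (@scalerI _ _ (2^-1 : C)) => //.
by rewrite invr_eq0 pnatr_eq0.
Qed.

End OperatorTernary.

Section WordAdjoints.
Variables (R : realType) (H : hilbertSpace R) (n : nat).
Variable L : bool -> 'I_n -> H -> H.
Hypothesis Ladj : forall b i, adjoints (L b i) (L (~~ b) i).

(** Reversal puts the last letter first with its star toggled, which accounts for the parity in the
    starting flag. *)
Lemma word_adjoints b l :
  adjoints (word L b l) (word L (b (+) odd (size l)) (rev l)).
Proof.
elim: l b => [|i l IH] b.
  by split=> //; split=> // x; exact: cvg_id.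
rewrite rev_cons -cats1 word_cat size_rev.
have -> : b (+) odd (size (i :: l)) = ~~ b (+) odd (size l).
  by rewrite /= addbN addNb.
have := adjoints_comp (Ladj b i) (IH (~~ b)); congr adjoints.
have -> : odd (size l) (+) (~~ b (+) odd (size l)) = ~~ b by case: b (odd _) =>
  [] [].
by [].
Qed.

(** For odd words the reversed middle factor begins and ends with starred letters, so the
    concatenation still alternates. *)
Lemma op_tern_word l1 l2 l3 :
    odd (size l1) -> odd (size l2) -> odd (size l3) ->
  op_tern (word L false l1) (word L false l2) (word L false l3) =
  word L false (l1 ++ rev l2 ++ l3).
Proof.
move=> o1 o2 o3; rewrite /op_tern (adjointE (word_adjoints _ l2)) o2 !word_cat.
by rewrite size_rev o1 o2.
Qed.

End WordAdjoints.

Section CstarTernary.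
Variables (R : realType) (A : cstarAlgebra R).

Lemma cs_tern_sesqui : sesqui_ternary (@cs_tern R A) setT.
Proof.
move=> a x x' y z _ _ _ _; rewrite /cs_tern; split.
- by rewrite !(linearDl, linearZl_LR).
- by rewrite cs_starD cs_starZ linearDr linearZr_LR /= linearDl linearZl_LR.
- by rewrite linearDr linearZr_LR.
Qed.

Lemma setT_subspace : subspace [set: A].
Proof. by []. Qed.

Variables (n : nat) (u : 'I_n -> A).
Hypothesis u_grid : rank1_grid u.

Lemma grid_rel i j k : jordan (@cs_tern R A) (u i) (u j) (u k) =
  2^-1 *: ((i == j)%:R *: u k + (j == k)%:R *: u i).
Proof.
have jC x y z : jordan (@cs_tern R A) x y z = jordan (@cs_tern R A) z y x.
  by rewrite /jordan addrC.
have [<-|ij] := eqVneq i j.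
  have [<-|ik] := eqVneq i k.
    rewrite rg_tripotent// -scalerDl scalerA (mulVf (x := 2)) ?scale1r//.
    by rewrite pnatr_eq0.
  by rewrite rg_2// scale1r scale0r addr0.
have [<-|jk] := eqVneq j k.
  by rewrite jC rg_2 ?[j == i]eq_sym// 1?eq_sym// scale1r scale0r add0r.
rewrite !scale0r addr0 scaler0; have [<-|ik] := eqVneq i k; first exact: rg_1.
exact: rg_3.
Qed.

Lemma grid_jordan (a b d : 'I_n -> R[i]) :
  jordan (@cs_tern R A)
    (\sum_i a i *: u i) (\sum_i b i *: u i) (\sum_i d i *: u i) =
  2^-1 *: ((\sum_i a i * (b i)^*%C) *: (\sum_i d i *: u i) +
           (\sum_i d i * (b i)^*%C) *: (\sum_i a i *: u i)).
Proof.
by apply: (jordan_sum setT_subspace cs_tern_sesqui); [|exact: grid_rel].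
Qed.

(** For [x] the given sum, [{x, u_k, u_k} = (a_k u_k + x) / 2]; hence [x = 0] forces
    [a_k u_k = 0]. *)
Lemma grid_free (a : 'I_n -> R[i]) : \sum_i a i *: u i = 0 -> forall i, a i = 0.
Proof.
move=> a0 k.
pose e (i : 'I_n) : R[i] := (i == k)%:R.
have eE (V : lmodType R[i]) (w : 'I_n -> V) : \sum_i e i *: w i = w k.
  exact: sum_delta.
have ce (c : 'I_n -> R[i]) : \sum_i c i * (e i)^*%C = c k.
  rewrite (bigD1 k)//= /e eqxx rmorph1 mulr1 big1 ?addr0// => i /negPf ->.
  by rewrite rmorph0 mulr0.
have := grid_jordan a e e; rewrite a0 !eE !ce scaler0 addr0.
have -> : jordan (@cs_tern R A) 0 (u k) (u k) = 0.
  rewrite /jordan /cs_tern linear0l linear0l linear0r addr0 scaler0 //.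
move=> /esym/eqP; rewrite !scaler_eq0 invr_eq0 pnatr_eq0 /=.
by rewrite (negPf (rg_neq0 u_grid k)) orbF => /eqP.
Qed.

End CstarTernary.

Section Ell2Adjoint.
Variables (R : realType) (I : finType).
Local Notation F := (ell2 R I).
Local Notation H := (ell2_hilbert R I).
Local Notation e := (ell2_basis R).

Lemma ell2_linear_coord (f : F -> F) x i : linear f ->
  f x i = \sum_j x j * f (e j) i.
Proof.
move=> fl; rewrite {1}[x]ell2_sum_basis.
pose g : {linear F -> F} := HB.pack f (GRing.isLinear.Build _ _ _ _ f fl).
rewrite -[f _]/(g _) linear_sum.
rewrite (big_morph (fun f : F => f i) (id1 := 0) (op1 := +%R)); last 2 first.
- by move=> y z; rewrite ffunE.
- by rewrite ffunE.
by apply: eq_bigr => j _; rewrite linearZ ell2_scaleE.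
Qed.

Lemma ell2_adjoints (f : H -> H) : linear f ->
  adjoints f (fun y : F => [ffun j => \sum_i (f (e j) i)^*%C * y i] : F).
Proof.
move=> fl; split; first exact: ell2_linear_bounded.
  apply: ell2_linear_bounded => a x y; apply/ffunP => j.
  rewrite !(ell2_scaleE, ffunE) mulr_sumr -big_split; apply: eq_bigr => i _ /=.
  by rewrite !(ell2_scaleE, ffunE) mulrDr mulrCA.
move=> x y; rewrite -[LHS]/(\sum_i f x i * (y i)^*%C).
rewrite -[RHS]/(\sum_j x j * _^*%C).
under eq_bigr do rewrite (ell2_linear_coord _ _ fl) mulr_suml.
rewrite exchange_big; apply: eq_bigr => j _; rewrite ffunE rmorph_sum mulr_sumr.
by apply: eq_bigr => i _; rewrite rmorphM /= conjcK mulrA.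
Qed.

Lemma ell2_op_tern_coord (f g h : H -> H) i j :
  linear f -> linear g -> linear h ->
  (op_tern f g h (e j) : F) i =
  \sum_k \sum_l f (e k) i * (g (e k) l)^*%C * h (e j) l.
Proof.
move=> fl gl hl; rewrite /op_tern (adjointE (ell2_adjoints gl)) /=.
rewrite (ell2_linear_coord _ _ fl); apply: eq_bigr => k _.
rewrite ffunE mulr_suml; apply: eq_bigr => l _; ring.
Qed.

End Ell2Adjoint.

(** * The enveloping TRO *)

Section LinearOn.
Variables (K : fieldType) (V W : lmodType K) (S : set V) (f : V -> W).
Hypotheses (SS : subspace S)
  (f_lin : forall a x y, S x -> S y -> f (a *: x + y) = a *: f x + f y).

Lemma linear_on0 : f 0 = 0.
Proof. by have := f_lin (-1) SS.1 SS.1; rewrite !scaleN1r !addNr. Qed.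

Lemma sum_linear_on (I : finType) (a : I -> K) (w : I -> V) :
  (forall i, S (w i)) -> f (\sum_i a i *: w i) = \sum_i a i *: f (w i).
Proof.
move=> Sw; pose P (y : W) (x : V) := S x /\ f x = y.
suff [] : P (\sum_i a i *: f (w i)) (\sum_i a i *: w i) by [].
apply: (big_rec2 P) => [|i y x _ [Sx <-]]; first by split;
  [exact: SS.1|exact: linear_on0].
by split; [exact: SS.2|rewrite f_lin].
Qed.

End LinearOn.

(** * The grid represented by creation operators *)

Section FockRepresentation.
Variables (R : realType) (A : cstarAlgebra R) (n : nat) (u : 'I_n -> A).
Hypothesis u_grid : rank1_grid u.
Local Notation C := R[i].
Local Notation F := (ell2 R {set 'I_n}).
Local Notation H := (ell2_hilbert R {set 'I_n}).

(** Linear extension of [u i |-> create i], made total on [A] by choosing coefficients: they are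
    unique on the span by [grid_free] and default to [0] outside it. *)
Definition fock_rep (x : A) : H -> H :=
  \sum_i (xget (fun=> 0) [set a : 'I_n -> C | x = \sum_i a i *: u i]) i *:
    (@create R n i : H -> H).

Lemma fock_repE (a : 'I_n -> C) :
  fock_rep (\sum_i a i *: u i) = \sum_i a i *: (@create R n i : H -> H).
Proof.
rewrite /fock_rep; case: xgetP => [b _ ab|/(_ a)]; last by case.
apply: eq_bigr => i _; congr (_ *: _); apply/eqP; rewrite -subr_eq0.
apply/eqP; move: i; apply: (grid_free u_grid).
under eq_bigr do rewrite scalerBl.
by rewrite sumrB -ab subrr.
Qed.

Lemma create_adjointable i : adjointable (@create R n i : H -> H).
Proof. exact: adjointableP (create_annihilate_adjoints R i). Qed.

Lemma create_jordan i j k :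
  jordan (@op_tern R H) (@create R n i) (@create R n j) (@create R n k) =
  2^-1 *: ((i == j)%:R *: (@create R n k : H -> H) +
           (j == k)%:R *: (@create R n i : H -> H)).
Proof.
rewrite /jordan /op_tern (adjointE (create_annihilate_adjoints R j)).
by congr (_ *: _); apply/funext => x; exact: create_rel.
Qed.

Lemma fock_rep_jb_hom : jb_hom (linspan u) (@bounded_op R H) fock_rep.
Proof.
have fockS (a : 'I_n -> C) :
  adjointable (\sum_i a i *: (@create R n i : H -> H)).
  exact: (subspace_sum _ (adjointable_subspace H) create_adjointable).
split.
- by move=> _ [a ->]; rewrite fock_repE; have [] := fockS a.
- move=> c _ _ [a ->] [b ->]; rewrite scaler_sumr -big_split /=.
  under eq_bigr do rewrite scalerA -scalerDl.
  rewrite !fock_repE scaler_sumr -big_split /=.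
  by apply: eq_bigr => i _; rewrite scalerDl scalerA.
have comb (V : lmodType C) (w : 'I_n -> V) (a d : 'I_n -> C) (s t : C) :
    2^-1 *: (s *: (\sum_i d i *: w i) + t *: (\sum_i a i *: w i)) =
    \sum_i (2^-1 * (s * d i + t * a i)) *: w i.
  rewrite !scaler_sumr -big_split scaler_sumr; apply: eq_bigr => i _ /=.
  by rewrite !scalerA -scalerDl scalerA.
move=> _ _ _ [a ->] [b ->] [d ->].
rewrite (grid_jordan u_grid) comb !fock_repE
  (jordan_sum (adjointable_subspace H)
  (@op_tern_sesqui R H) _ _ _ create_adjointable create_jordan).
by rewrite comb.
Qed.

End FockRepresentation.

(** * Subsets of fixed size as matrix indices *)

Section SubsetsOfSize.
Variables (n k : nat).

Let cardE : #|[set S : {set 'I_n} | #|S| == k]%SET| = 'C(n, k).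
Proof. by rewrite card_draws card_ord. Qed.

Definition kth_subset (a : 'I_('C(n, k))) : {set 'I_n} :=
  enum_val (cast_ord (esym cardE) a).

Lemma card_kth_subset a : #|kth_subset a| = k.
Proof. by have := enum_valP (cast_ord (esym cardE) a); rewrite inE => /eqP. Qed.

Lemma kth_subset_inj : injective kth_subset.
Proof. by move=> a b /enum_val_inj/cast_ord_inj. Qed.

Lemma kth_subset_onto (S : {set 'I_n}) : #|S| = k -> exists a, S = kth_subset a.
Proof.
move=> cS; have Sin : S \in [set S : {set 'I_n} | #|S| == k]%SET by rewrite inE
  cS.
exists (cast_ord cardE (enum_rank_in Sin S)).
by rewrite /kth_subset cast_ordK enum_rankK_in.
Qed.

Lemma sum_kth_subset (V : nmodType) (G : {set 'I_n} -> V) :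
  (forall S : {set 'I_n}, #|S| != k -> G S = 0) ->
  \sum_S G S = \sum_a G (kth_subset a).
Proof.
move=> G0; rewrite (bigID (fun S : {set 'I_n} => S \in codom kth_subset)) /=
  addrC big1 ?add0r.
  rewrite -big_uniq /= ?codomE; last first.
    by rewrite map_inj_uniq ?enum_uniq//; exact: kth_subset_inj.
  by rewrite big_map big_enum.
move=> S SN; apply: G0; apply: contra SN => /eqP/kth_subset_onto[a ->].
exact: codom_f.
Qed.

End SubsetsOfSize.

(** * Words spanning the enveloping TRO *)

Section Enveloping.
Variables (R : realType) (A : cstarAlgebra R) (n : nat) (u : 'I_n -> A).
Hypothesis u_grid : rank1_grid u.
Variables (H : hilbertSpace R) (T : set (H -> H)) (rho : A -> H -> H).
Hypothesis T_univ : universal_enveloping_tro (linspan u) T rho.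
Local Notation C := R[i].
Local Notation F := (ell2 R {set 'I_n}).
Local Notation HF := (ell2_hilbert R {set 'I_n}).
Local Notation e := (ell2_basis R).

Definition env_letter (b : bool) (i : 'I_n) : H -> H :=
  if b then adjoint (rho (u i)) else rho (u i).

Local Notation W := (word env_letter false).

Let T_tro : tro T. Proof. by case: T_univ. Qed.
Let rho_hom : jb_hom (linspan u) T rho. Proof. by case: T_univ. Qed.
Let rho_in_T i : T (rho (u i)).
Proof. by case: rho_hom => h _ _; apply/h/linspan_gen. Qed.

Lemma rho_sum (a : 'I_n -> C) :
  rho (\sum_i a i *: u i) = \sum_i a i *: rho (u i).
Proof.
have [_ rho_lin _] := rho_hom.
by rewrite (sum_linear_on (linspan_subspace u) rho_lin)//; exact: linspan_gen.
Qed.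

Lemma rho_rel i j k :
  (rho (u i) \o adjoint (rho (u j)) \o rho (u k)) +
  (rho (u k) \o adjoint (rho (u j)) \o rho (u i)) =
  (i == j)%:R *: rho (u k) + (j == k)%:R *: rho (u i).
Proof.
apply: op_tern_rel; have [_ rho_lin rho_tern] := rho_hom.
have uu := linspan_gen u; have us := linspan_subspace u.
rewrite -rho_tern// (grid_rel u_grid) -[X in rho X]addr0 rho_lin.
- rewrite rho_lin//; last exact: subspaceZ.
  rewrite -[_ *: u i]addr0 rho_lin//; last exact: us.1.
  by rewrite (linear_on0 us rho_lin) !addr0.
- by apply: subspaceD => //; exact: subspaceZ.
- exact: us.1.
Qed.

(** [rho_rel] at three equal indices is twice the tripotent equation, from which
    [adjoints_tripotent] obtains a genuine adjoint. *)
Lemma rho_adjoints i : adjoints (rho (u i)) (adjoint (rho (u i))).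
Proof.
apply: adjoints_tripotent; first by have [Tb _ _ _] := T_tro; exact: Tb.
apply: (@scalerI _ _ (2 : C)); first by rewrite pnatr_eq0.
have := rho_rel i i i; rewrite eqxx -!scalerDl => <-.
by rewrite scalerDl scale1r.
Qed.

Lemma env_letter_adjoints b i : adjoints (env_letter b i) (env_letter (~~ b) i).
Proof. by case: b; [apply: adjoints_sym|]; exact: rho_adjoints. Qed.

Lemma env_letter_linear b i : linear (env_letter b i).
Proof. by have [[]] := env_letter_adjoints b i. Qed.

(** The starred case is the adjoint of the unstarred one. *)
Lemma env_letter_rel b i j k :
  (env_letter b i \o env_letter (~~ b) j \o env_letter b k) +
  (env_letter b k \o env_letter (~~ b) j \o env_letter b i) =
  (i == j)%:R *: env_letter b k + (j == k)%:R *: env_letter b i.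
Proof.
case: b; last exact: rho_rel.
have adj b p := env_letter_adjoints b p.
have := adjoints_lin 1
  (adjoints_comp (adjoints_comp (adj false k) (adj true j)) (adj false i))
  (adjoints_comp (adjoints_comp (adj false i) (adj true j)) (adj false k)).
rewrite scale1r rmorph1 scale1r => /adjointE <-.
have := adjoints_lin (k == j)%:R (adj false i)
  (adjoints_lin (j == i)%:R (adj false k) (adjoints0 H)).
rewrite !addr0 !rmorph_nat [k == j]eq_sym [j == i]eq_sym => /adjointE.
by rewrite [RHS]addrC => <-; rewrite rho_rel [k == j]eq_sym [j == i]eq_sym.
Qed.

Lemma W_cons2 i j l :
  W [:: i, j & l] = op_tern (rho (u i)) (rho (u j)) (W l).
Proof. by []. Qed.

Lemma odd_size_ind (P : seq 'I_n -> Prop) : (forall i, P [:: i]) ->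
  (forall i j l, odd (size l) -> P l -> P [:: i, j & l]) ->
  forall l, odd (size l) -> P l.
Proof.
move=> P1 P2 l; have [m] := ubnP (size l); elim: m l => // m IH [|i [|j l]] //=.
by rewrite negbK !ltnS => lm ol; apply: P2 => //; apply: IH => //; exact: ltnW.
Qed.

Lemma W_in_T l : odd (size l) -> T (W l).
Proof.
have [_ _ _ T_tern] := T_tro.
apply: (odd_size_ind (P := fun l => T (W l))) => {l} [i|i j l _ Tl].
  exact: rho_in_T.
by rewrite W_cons2; apply: T_tern.
Qed.

Definition pairs := {p : {set 'I_n} * {set 'I_n} | #|p.1| == #|p.2|.+1}.

Definition pair (k : 'I_#|{: pairs}|) : {set 'I_n} * {set 'I_n} :=
  val (enum_val k).

Lemma pairP k : #|(pair k).1| = #|(pair k).2|.+1.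
Proof. by apply/eqP; exact: (valP (enum_val k)). Qed.

Lemma pair_onto (I J : {set 'I_n}) : #|I| = #|J|.+1 ->
  exists k, pair k = (I, J).
Proof.
move=> cIJ; have h : #|(I, J).1| == #|(I, J).2|.+1 by apply/eqP.
by exists (enum_rank (Sub (I, J) h : pairs)); rewrite /pair enum_rankK.
Qed.

Lemma pair_inj : injective pair.
Proof. by move=> k l /val_inj/enum_val_inj. Qed.

Definition pair_word k := W (interleave (enum (pair k).1) (enum (pair k).2)).

Lemma odd_pair_word k :
  odd (size (interleave (enum (pair k).1) (enum (pair k).2))).
Proof.
rewrite size_interleave -!cardE pairP ?leqnSn ?leqnn//.
by rewrite addSn addnn /= odd_double.
Qed.

Lemma pair_word_span l : odd (size l) -> linspan pair_word (W l).
Proof.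
apply: (words_span _ env_letter_linear env_letter_rel).
- by rewrite pnatr_eq0.
- exact: linspan_subspace.
- by move=> I J /pair_onto[k kE]; have := linspan_gen pair_word k;
    rewrite /pair_word kE.
Qed.

Lemma pair_word_adjointable k : adjointable (pair_word k).
Proof. exact: adjointableP (word_adjoints env_letter_adjoints _ _). Qed.

(** Makes the span a competitor in the minimality clause of [tro_generated_by], so that [T] is
    contained in it. *)
Lemma span_tro : tro (linspan pair_word).
Proof.
split.
- move=> _ [c ->].
  by have [] := subspace_sum c (adjointable_subspace H) pair_word_adjointable.
- exact: linspan_subspace.
- exact: linspan_opnorm_closed.
- move=> x y z; apply: (ternary_sum_subspace (adjointable_subspace H)
    (@op_tern_sesqui R H)).
    exact: pair_word_adjointable.
  move=> i j k; rewrite (op_tern_word env_letter_adjoints) ?odd_pair_word//.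
  apply: pair_word_span; rewrite !size_cat size_rev !oddD !odd_pair_word //.
Qed.

Lemma T_span t : T t -> linspan pair_word t.
Proof.
have [_ _ [_ T_min] _] := T_univ; apply: T_min; first exact: span_tro.
move=> _ [_ [a ->] <-]; rewrite rho_sum.
apply: subspace_sum => [|i]; first exact: linspan_subspace.
exact: (@pair_word_span [:: i]).
Qed.

Lemma pair_word_in_T k : T (pair_word k).
Proof. exact/W_in_T/odd_pair_word. Qed.

(** * Comparison with block matrices *)

Section Comparison.
Variable phi : (H -> H) -> HF -> HF.
Hypothesis phi_hom : tro_hom T (@bounded_op R HF) phi.
Hypothesis phi_rho : forall i, phi (rho (u i)) = @create R n i.

Let T_subspace : subspace T. Proof. by case: T_tro. Qed.
Let phi_lin (a : C) x y : T x -> T y -> phi (a *: x + y) = a *: phi x + phi y.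
Proof. by case: phi_hom => _ h _; exact: h. Qed.
Let phi_linear t : T t -> linear (phi t).
Proof. by case: phi_hom => h _ _ /h[]. Qed.

Lemma phi_hop i j t : T t ->
  phi (op_tern (rho (u i)) (rho (u j)) t) =
  @create R n i \o @annihilate R n j \o phi t.
Proof.
move=> Tt; have [_ _ phi_tern] := phi_hom; rewrite phi_tern// !phi_rho /op_tern.
by rewrite (adjointE (create_annihilate_adjoints R j)).
Qed.

Definition coef t (I J : {set 'I_n}) : C := (phi t (e J) : F) I.

Lemma coef_lin a t t' I J : T t -> T t' ->
  coef (a *: t + t') I J = a * coef t I J + coef t' I J.
Proof.
by move=> Tt Tt'; rewrite /coef phi_lin//;
  rewrite op_linE [LHS]ffunE [X in X + _]ell2_scaleE.
Qed.

Lemma coef_sum (N : nat) (c : 'I_N -> C) (w : 'I_N -> (H -> H)) I J :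
  (forall k, T (w k)) ->
  coef (\sum_k c k *: w k) I J = \sum_k c k * coef (w k) I J.
Proof.
move=> Tw; exact: (@sum_linear_on C (H -> H) C^o T
  (fun t => coef t I J) T_subspace
  (fun a x y => coef_lin a I J) _ c w Tw).
Qed.

(** An odd word has one more creation operator than annihilation operators, so it raises the degree
    by one. *)
Lemma coef_W_grade l (I J : {set 'I_n}) : odd (size l) -> #|I| != #|J|.+1 ->
  coef (W l) I J = 0.
Proof.
move=> ol; move: l ol I; apply: odd_size_ind => [i|i j l ol IH] I IJ.
  by rewrite /coef phi_rho create_basis_grade.
rewrite /coef W_cons2 phi_hop; last exact: W_in_T.
rewrite /= !ffunE.
case: ifP => // iI; case: ifP => jI; first by rewrite mulr0.
rewrite [X in _ * (_ * X)]IH ?mulr0//.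
by move: IJ; rewrite cardsU1 jI (cardsD1 i I) iI.
Qed.

Let coef_T_grade t (I J : {set 'I_n}) : T t -> #|I| != #|J|.+1 ->
  coef t I J = 0.
Proof.
move=> /T_span[c ->] IJ; rewrite coef_sum; last exact: pair_word_in_T.
by rewrite big1// => k _; rewrite coef_W_grade ?mulr0 ?odd_pair_word.
Qed.

Lemma munit_in_image (I J : {set 'I_n}) : #|I| = #|J|.+1 ->
  exists2 t, T t & phi t = @munit R n I J.
Proof.
move=> cIJ; have [_ _ _ T_tern] := T_tro.
suff [t Tt <-] : (phi @` T) (@munit R n I J) by exists t.
apply: generate_munit cIJ.
- split; first by exists 0;
    [exact: T_subspace.1|exact: (linear_on0 T_subspace phi_lin)].
  move=> a _ _ [t Tt <-] [t' Tt' <-]; exists (a *: t + t'); last exact: phi_lin.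
  exact: T_subspace.2.
- by move=> i; exists (rho (u i)).
- move=> i j _ [t Tt <-]; exists (op_tern (rho (u i)) (rho (u j)) t).
    exact: T_tern.
  exact: phi_hop.
Qed.

(* The spanning words and the matrix units are equinumerous, so the square
   matrix of coefficients of the former is invertible. *)
Lemma coef_inj t : T t -> (forall I J, coef t I J = 0) -> t = 0.
Proof.
move=> /T_span[c ->] c0.
pose G := \matrix_(k, l) coef (pair_word k) (pair l).1 (pair l).2.
(* Row [l] of [X] expands, in the spanning words, a preimage of the matrix unit of the [l]-th
   pair. *)
have [X XG] : exists X, X *m G = 1%:M.
  have Xrow l : {d : 'I_#|{: pairs}| -> C |
      phi (\sum_k d k *: pair_word k) = @munit R n (pair l).1 (pair l).2}.
    apply: cid; have [t' /T_span[d ->] dE] := munit_in_image (pairP l).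
    by exists d.
  exists (\matrix_(l, k) sval (Xrow l) k); apply/matrixP => l l'; rewrite !mxE.
  transitivity (coef (\sum_k sval (Xrow l) k *: pair_word k)
                     (pair l').1 (pair l').2).
    rewrite coef_sum; last exact: pair_word_in_T.
    by apply: eq_bigr => k _; rewrite !mxE.
  rewrite /coef (svalP (Xrow l)) munit_coef [(pair l).2 == _]eq_sym -xpair_eqE.
  by rewrite -!surjective_pairing (inj_eq pair_inj) eq_sym.
have cG : (\row_k c k) *m G = 0.
  apply/rowP => l; rewrite !mxE -[RHS](c0 (pair l).1 (pair l).2) coef_sum.
    by apply: eq_bigr => k _; rewrite !mxE.
  exact: pair_word_in_T.
have c_eq0 : \row_k c k = 0.
  by rewrite -[LHS]mulmx1 -(mulmx1C XG) mulmxA cG mul0mx.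
by rewrite big1// => k _; have /rowP/(_ k) := c_eq0; rewrite !mxE => ->;
  rewrite scale0r.
Qed.

Lemma coef_tern x y z I J : T x -> T y -> T z ->
  coef (op_tern x y z) I J =
  \sum_K \sum_L coef x I K * (coef y L K)^*%C * coef z L J.
Proof.
move=> Tx Ty Tz; have [_ _ phi_tern] := phi_hom.
by rewrite /coef phi_tern// ell2_op_tern_coord//; exact: phi_linear.
Qed.

Local Notation S k := (@kth_subset n k).
Local Notation M :=
  (mxsum R (fun k : 'I_n => 'C(n, k.+1)) (fun k : 'I_n => 'C(n, k))).

(** Block [k] is the part of [phi t] from degree [k] to degree [k.+1]. As ['I_n] starts at [0], it
    is the summand numbered k + 1 when the summands are counted from 1 to n. *)
Definition coef_blocks t : M :=
  [ffun k : 'I_n => \matrix_(a, b) coef t (S k.+1 a) (S k b)].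

(** In [coef_tern] the grading kills all terms except those with [K] of size [k] and [L] of size
    [k.+1], which form the product of the [k]-th blocks. *)
Lemma coef_blocks_hom :
  ternary_hom (@op_tern R H) (@mxsum_tern R _ _ _) T setT coef_blocks.
Proof.
split=> // [a x y Tx Ty|x y z Tx Ty Tz]; apply/ffunP => k; rewrite !ffunE.
  by apply/matrixP => i j; rewrite !mxE coef_lin.
apply/matrixP => i j; rewrite !mxE coef_tern// exchange_big /=.
rewrite (@sum_kth_subset n k.+1) => [|L cL]; last first.
  apply: big1 => K _; rewrite (coef_T_grade (t := z)) ?mulr0//.
  by rewrite card_kth_subset.
apply: eq_bigr => l _; rewrite !mxE mulr_suml.
rewrite (@sum_kth_subset n k) => [|K cK]; last first.
  by rewrite (coef_T_grade (t := x)) ?mul0r// card_kth_subset eqSS eq_sym.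
by apply: eq_bigr => m _; rewrite !mxE.
Qed.

Lemma coef_blocks_bij : set_bij T setT coef_blocks.
Proof.
have blocks_coef t t' : T t -> T t' -> coef_blocks t = coef_blocks t' ->
    forall I J, coef t I J = coef t' I J.
  move=> Tt Tt' tt' I J; have [cIJ|IJ] := eqVneq #|I| #|J|.+1; last first.
    by rewrite !coef_T_grade.
  have Jn : (#|J| < n)%N.
    by rewrite -cIJ; have := max_card (mem I); rewrite card_ord.
  pose k := Ordinal Jn.
  have [a ->] := @kth_subset_onto n k.+1 I cIJ.
  have [b ->] := @kth_subset_onto n k J erefl.
  by have /ffunP/(_ k) := tt'; rewrite !ffunE => /matrixP/(_ a b); rewrite !mxE.
split=> // [t t' /set_mem Tt /set_mem Tt' tt'|x _].
  apply/eqP; rewrite -subr_eq0; apply/eqP/coef_inj; first exact: subspaceB.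
  move=> I J; rewrite addrC -scaleN1r coef_lin// (blocks_coef t t')//.
  by rewrite mulN1r addNr.
(* Spreads the entries of [x] over pairs of subsets; summing over all block positions avoids
   inverting the dependent indexing [kth_subset]. *)
pose entry (I J : {set 'I_n}) : C := \sum_(k < n) \sum_a \sum_b
  (((I == S k.+1 a) && (J == S k b))%:R * x k a b).
have /choice[m mE] (k : 'I_#|{: pairs}|) :
    exists t, T t /\ phi t = @munit R n (pair k).1 (pair k).2.
  by have [t] := munit_in_image (pairP k); exists t.
exists (\sum_k entry (pair k).1 (pair k).2 *: m k).
  by apply: subspace_sum => // k; have [] := mE k.
apply/ffunP => k; rewrite ffunE; apply/matrixP => a b; rewrite mxE.
rewrite coef_sum => [|l]; last by have [] := mE l.
have [l lE] : exists l, pair l = (S k.+1 a, S k b).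
  by apply: pair_onto; rewrite !card_kth_subset.
rewrite (bigD1 l)//= [X in _ + X]big1 ?addr0 => [|l' ll']; last first.
  rewrite /coef (mE l').2 munit_coef [(pair l').2 == _]eq_sym -xpair_eqE.
  by rewrite -surjective_pairing -lE (inj_eq pair_inj) eq_sym (negPf ll') mulr0.
rewrite /coef (mE l).2 munit_coef lE /= !eqxx mulr1 /entry.
rewrite (bigD1 k)//= [X in _ + X]big1 ?addr0 => [|k' kk']; last first.
  apply: big1 => a' _; apply: big1 => b' _; case: eqP; rewrite ?mul0r// => E.
  case/eqP: kk'; apply/val_inj; have := congr1 (fun A : {set 'I_n} => #|A|) E.
  by rewrite !card_kth_subset => -[].
rewrite (bigD1 a)//= [X in _ + X]big1 ?addr0 => [|a' aa']; last first.
  by apply: big1 => b' _; rewrite (inj_eq (@kth_subset_inj _ _)) eq_sym (negPf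
    aa') mul0r.
rewrite (bigD1 b)//= [X in _ + X]big1 ?addr0 => [|b' bb']; last first.
  by rewrite [_ == S k b']eq_sym (inj_eq (@kth_subset_inj n k)) (negPf bb')
    andbF mul0r.
by rewrite !eqxx mul1r.
Qed.

End Comparison.

End Enveloping.

Theorem theorem3p15 (R : realType) (A : cstarAlgebra R) (Z : set A)
    (n : nat) (u : 'I_n -> A)
    (n_gt0 : (0 < n)%N)
    (Z_jc : jc_triple Z)
    (u_grid : rank1_grid u)
    (Z_span : Z = linspan u)
    (H : hilbertSpace R) (T : set (H -> H)) (rho : A -> H -> H)
    (T_univ : universal_enveloping_tro Z T rho) :
  ternary_iso (@op_tern R H)
    (@mxsum_tern R 'I_n (fun k => 'C(n, k.+1)) (fun k => 'C(n, k)))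
    T setT.
Proof.
rewrite Z_span in T_univ; have [_ _ _ T_fact] := T_univ.
have [phi phi_hom phi_rho] :=
  T_fact _ _ _ (@tro_bounded_op R _) (fock_rep_jb_hom u_grid).
have phi_create i : phi (rho (u i)) = @create R n i.
  rewrite -phi_rho; last exact: linspan_gen.
  by rewrite -[u i]sum_delta fock_repE// sum_delta.
exists (coef_blocks phi); split; first exact: (coef_blocks_hom u_grid T_univ).
exact: (coef_blocks_bij u_grid T_univ).
Qed.
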